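(* Let $h_{\mathrm{cube}}(x)=1/\log_2(1/x)$ and $h_{\mathrm{proj}}(x)=\sqrt{2x}$ (with value $0$ at $x=0$), and let $\mu_{\mathrm{cube}}$, $\mu_{\mathrm{proj}}$ be the Hausdorff measures on $[0,1]$ with these gauge functions. Let $$S_{\mathrm{cube}}=\Big\{\sum_{j=1}^\infty a_j2^{-j}: a_j\in\{0,1\},\ a_1=a_2,\ a_3=a_4,\ a_5=\dots=a_8,\ a_9=\dots=a_{16},\dots\Big\}$$ (digits constant on the blocks $\{1,2\}$ and $\{2^i+1,\dots,2^{i+1}\}$, $i\ge1$) and $$S_{\mathrm{proj}}=\Big\{\sum_{j=1}^\infty a_j2^{-j}: a_j\in\{0,1\},\ a_1=a_2=a_3,\ a_4=a_5,\ a_6=a_7,\ a_8=a_9,\dots\Big\}$$ (digits constant on the blocks $\{1,2,3\}$ and $\{2i,2i+1\}$, $i\ge2$). For each subscript $*\in\{\mathrm{cube},\mathrm{proj}\}$ let $\mathbf{G}_*=([0,1],\mathcal{B},\lambda,\mu_*,W_* )$, where $\mathcal{B}$ is the Borel $\sigma$-algebra of $[0,1]$, $\lambda$ is Lebesgue measure, and $W_*(x,y)=1$ if $|x-y|\in S_*$ and $W_*(x,y)=0$ otherwise. Then: (a) $(Q_d,d)\to\mathbf{G}_{\mathrm{cube}}$ as a Euclidean limit as $d\to\infty$, where $Q_d=\{0,1\}^d$ is the hypercube graph. (b) If $G_n$ is the (bipartite point-line) incidence graph of a projective plane of order $q_n$, and $q_n\to\infty$, then $(G_n,q_n+1)\to\mathbf{G}_{\mathrm{proj}}$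 as a Euclidean limit as $n\to\infty$.
   Context: Graphs are finite, simple and undirected; $\mathrm{v}(F)$, $\mathrm{c}(F)$ are the numbers of nodes and connected components of $F$; $\hom(F,G)$ is the number of homomorphisms from $F$ to $G$. An admissible pair is a pair $(G,d)$ where $d\ge 1$ and $G$ is a graph with all degrees $\le d$; an admissible sequence is a sequence of admissible pairs. $t(F,G,d)=\hom(F,G)/\big(\mathrm{v}(G)^{\mathrm{c}(F)}d^{\,\mathrm{v}(F)-\mathrm{c}(F)}\big)$. An admissible sequence is convergent if $t(F,G_n,d_n)$ converges for every graph $F$. A graphoning is a tuple $\mathbf{G}=(X,\mathcal{B},\lambda,\mu,W)$, where $(X,\mathcal{B},\lambda)$ is a probability space, $\mu:\mathcal{B}\to[0,\infty]$ is a measure, and $W:X^2\to[0,1]$ is a symmetric $(\mathcal{B}\otimes\mathcal{B})$-measurable function such that: $\deg_X(x)\le1$ for all $x\in X$, where $\deg_A(x)=\int_AW(x,y)\,d\mu(y)$; $\deg_A$ is a measurable function on $X$ for all $A\in\mathcal{B}$; and $\int_A\deg_B\,d\lambda=\int_B\deg_A\,d\lambda$ for all $A,B\in\mathcal{B}$. For a connected graph $F$, an admissible labeling is a bijection $V(F)\to\{0,1,\dots,\mathrm{v}(F)-1\}$ such that for all $1\le i\le\mathrm{v}(F)$ the nodes with labels less than $i$ span a connected subgraph. Identifying nodes with their labels, $t(F,\mathbf{G})=\int_X\int_X\cdots\int_X\prod_{kl\in E(F)}W(x_k,x_l)\,d\mu(x_{\mathrm{v}(F)-1})\cdots d\mu(x_1)\,d\lambda(x_0)$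 (iterated integral, innermost variable $x_{\mathrm{v}(F)-1}$); it does not depend on the admissible labeling. A gauge function is a right-continuous nondecreasing function $h\ge0$ on a right neighborhood of $0$ (including $0$); the corresponding Hausdorff measure is $\mu(B)=\lim_{\delta\to0}\inf\{\sum_{i=1}^\infty h(\mathrm{diam}\,I_i):\mathrm{diam}\,I_i<\delta\text{ for all }i,\ B\subseteq\bigcup_{i=1}^\infty I_i\}$ for Borel sets $B$. A Euclidean graphoning is a graphoning $([0,1],\mathcal{B},\lambda,\mu,W)$ where $[0,1]$ carries the Euclidean metric, $\mathcal{B}$ is the Borel $\sigma$-algebra, $\lambda$ is $1$-dimensional Hausdorff (i.e. Lebesgue) measure and $\mu$ is the Hausdorff measure of some gauge function $h$. ''$(G_n,d_n)\to\mathbf{G}$ as a Euclidean limit'' means: the sequence $(G_n,d_n)$ is convergent, $\mathbf{G}$ is a Euclidean graphoning with a gauge function $h$ such that $h(1/\mathrm{v}(G_n))\sim1/d_n$ as $n\to\infty$, and $t(F,G_n,d_n)\to t(F,\mathbf{G})$ for all connected graphs $F$. *)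

(* Defs.v *)
From HB Require Import structures.
From mathcomp Require Import all_boot all_order all_algebra.
From mathcomp Require Import all_classical all_reals all_analysis.
From mathcomp Require Import measurable_realfun.

Set Implicit Arguments.
Unset Strict Implicit.
Unset Printing Implicit Defensive.

Import Order.TTheory GRing.Theory Num.Theory.
Import numFieldNormedType.Exports.

Local Open Scope ring_scope.

Record sgraph := SGraph {
  vertex :> finType;
  adj : rel vertex;
  adj_sym : symmetric adj;
  adj_irr : irreflexive adj }.

Definition nv (F : sgraph) : nat := #|F|.

Definition nc (F : sgraph) : nat := n_comp (@adj F) F.

(* In particular the empty graph is not connected. *)
Definition connected_graph (F : sgraph) : Prop := nc F = 1%N.

Definition degree (G : sgraph) (x : G) : nat := #|[set y | adj x y]|.

Definition is_hom (F G : sgraph) (f : {ffun F -> G}) : bool :=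
  [forall u, forall v, adj u v ==> adj (f u) (f v)].

Definition hom (F G : sgraph) : nat := #|[set f : {ffun F -> G} | is_hom f]|.

Section Induced.
Variables (F : sgraph) (A : {set F}).
Let T : finType := {x : F | x \in A}.
Let e : rel T := fun x y => adj (val x) (val y).
Let e_sym : symmetric e. Proof. by move=> x y; apply: adj_sym. Qed.
Let e_irr : irreflexive e. Proof. by move=> x; apply: adj_irr. Qed.
Definition induced : sgraph := SGraph e_sym e_irr.
End Induced.

Definition admissible_labeling (F : sgraph) (lab : F -> 'I_(nv F)) : Prop :=
  bijective lab /\
  forall i, (1 <= i <= nv F)%N ->
    connected_graph (induced [set v : F | (lab v < i)%N]).

Section Hypercube.
Variable d : nat.
Let e : rel {ffun 'I_d -> bool} := fun f g => #|[set i | f i != g i]| == 1%N.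
Let e_sym : symmetric e.
Proof.
by move=> f g; rewrite /e; congr (_ == _); apply: eq_card => i;
  rewrite !inE eq_sym.
Qed.
Let e_irr : irreflexive e.
Proof.
by move=> f; rewrite /e eq_card0 // => i; rewrite !inE eqxx.
Qed.
Definition hypercube : sgraph := SGraph e_sym e_irr.
End Hypercube.

Record projective_plane (P L : finType) (inc : P -> L -> bool) (q : nat) :
    Prop := {
  plane_line : forall x y : P, x != y -> exists! l : L, inc x l && inc y l;
  plane_point : forall l m : L, l != m -> exists! x : P, inc x l && inc x m;
  plane_quadrangle : exists s : seq P, [/\ size s = 4%N, uniq s
    & forall l : L, (count (inc^~ l) s <= 2)%N];
  plane_order : forall l : L, #|[set x : P | inc x l]| = q.+1 }.

Section IncidenceGraph.
Variables (P L : finType) (inc : P -> L -> bool).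
Let e : rel (P + L)%type := fun u v =>
  match u, v with
  | inl x, inr l => inc x l
  | inr l, inl x => inc x l
  | _, _ => false
  end.
Let e_sym : symmetric e. Proof. by case=> ? [?|?]. Qed.
Let e_irr : irreflexive e. Proof. by case. Qed.
Definition incidence_graph : sgraph := SGraph e_sym e_irr.
End IncidenceGraph.

Local Open Scope classical_set_scope.
Local Open Scope ring_scope.

Definition admissible_pair (G : sgraph) (d : nat) : Prop :=
  (1 <= d)%N /\ forall x : G, (degree x <= d)%N.

Definition hom_density (R : realType) (F G : sgraph) (d : nat) : R :=
  (hom F G)%:R / ((nv G)%:R ^+ nc F * d%:R ^+ (nv F - nc F)).

Definition convergent (R : realType) (G : nat -> sgraph) (d : nat -> nat) :
    Prop :=
  forall F : sgraph, cvgn (fun n => hom_density R F (G n) (d n)).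

(* The underlying measurable space of a graphoning is a measurable subset [X]
   of a [measurableType], with the trace sigma-algebra: its measurable sets are
   the measurable [A] with [A `<=` X]. Measures are plain set functions, of
   which only the values on these sets matter. *)
Section Graphoning.
Variables (R : realType) (dT : measure_display) (T : measurableType dT).
Variables (X : set T).

Definition is_measure_on (m : set T -> \bar R) : Prop :=
  [/\ m set0 = 0%E,
      forall A, measurable A -> A `<=` X -> (0 <= m A)%E
    & forall A : nat -> set T,
        (forall i, measurable (A i) /\ A i `<=` X) -> trivIset setT A ->
        (fun n => \sum_(0 <= i < n) m (A i))%E @ \oo --> m (\bigcup_i A i)].

Definition gdeg (mu : set T -> \bar R) (W : T -> T -> R) (A : set T) (x : T) :
    \bar R :=
  (\int[mu]_(y in A) (W x y)%:E)%E.

Record graphoning (lambda mu : set T -> \bar R) (W : T -> T -> R) : Prop := {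
  graphoning_dom : measurable X;
  graphoning_lambda : is_measure_on lambda;
  graphoning_prob : lambda X = 1%E;
  graphoning_mu : is_measure_on mu;
  graphoning_range : forall x y, X x -> X y -> 0 <= W x y <= 1;
  graphoning_sym : forall x y, X x -> X y -> W x y = W y x;
  graphoning_meas : measurable_fun (X `*` X) (fun z : T * T => W z.1 z.2);
  graphoning_deg1 : forall x, X x -> (gdeg mu W X x <= 1)%E;
  graphoning_degm : forall A, measurable A -> A `<=` X ->
    measurable_fun X (gdeg mu W A);
  graphoning_reversible : forall A B,
    measurable A -> A `<=` X -> measurable B -> B `<=` X ->
    (\int[lambda]_(x in A) gdeg mu W B x =
     \int[lambda]_(x in B) gdeg mu W A x)%E }.

(* [iter_int mu n m x f] is the integral of [f] over the [n] coordinates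
   [m, ..., m + n - 1] of [x], the innermost variable being the last one. *)
Fixpoint iter_int (mu : set T -> \bar R) (n m : nat) (x : nat -> T)
    (f : (nat -> T) -> \bar R) : \bar R :=
  if n is n'.+1 then
    (\int[mu]_(y in X) iter_int mu n' m.+1 [eta x with m |-> y] f)%E
  else f x.

(* The condition [lab u < lab v] makes each edge occur once in the product. *)
Definition edge_prod (W : T -> T -> R) (F : sgraph) (lab : F -> 'I_(nv F))
    (x : nat -> T) : R :=
  \prod_(u : F) \prod_(v : F | adj u v && (lab u < lab v)%N)
    W (x (lab u)) (x (lab v)).

Definition graphoning_density (lambda mu : set T -> \bar R) (W : T -> T -> R)
    (F : sgraph) (lab : F -> 'I_(nv F)) : \bar R :=
  (\int[lambda]_(x0 in X)
     iter_int mu (nv F).-1 1 (fun=> x0) (fun x => (edge_prod W lab x)%:E))%E.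

End Graphoning.

Section Euclidean.
Variable R : realType.

Definition I01 : set (measurableTypeR R) := `[0%R, 1%R].

(* Only the values of [h] on some right neighborhood [0, e) of 0 matter. *)
Definition gauge (h : R -> R) : Prop :=
  exists2 e : R, 0 < e &
    [/\ forall x, 0 <= x < e -> 0 <= h x,
        forall x y, 0 <= x -> x <= y -> y < e -> h x <= h y
      & forall x, 0 <= x < e -> h y @[y --> x^'+] --> h x].

(* Used for subsets of [0,1] only; [sup set0 = 0], so that [diam set0 = 0]. *)
Definition diam (A : set R) : R := sup [set `|x - y| | x in A & y in A].

Definition hausdorff_cover (delta : R) (B : set R) (I : nat -> set R) : Prop :=
  (forall i, I i `<=` `[0, 1] /\ diam (I i) < delta) /\ B `<=` \bigcup_i I i.

Definition hausdorff_pre (h : R -> R) (delta : R) (B : set R) : \bar R :=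
  ereal_inf [set (\sum_(0 <= i <oo) (h (diam (I i)))%:E)%E
            | I in hausdorff_cover delta B].

Definition hausdorff (h : R -> R) (B : set (measurableTypeR R)) : \bar R :=
  lim (hausdorff_pre h delta B @[delta --> 0^'+]).

Definition euclidean_graphoning (mu : set (measurableTypeR R) -> \bar R)
    (W : measurableTypeR R -> measurableTypeR R -> R) (h : R -> R) : Prop :=
  [/\ graphoning I01 lebesgue_measure mu W,
      gauge h
    & forall B, measurable B -> B `<=` I01 -> mu B = hausdorff h B].

(* The density of a connected graph [F] in a graphoning does not depend on the
   admissible labeling; the limit is required for each of them. *)
Definition euclidean_limit (G : nat -> sgraph) (d : nat -> nat)
    (mu : set (measurableTypeR R) -> \bar R)
    (W : measurableTypeR R -> measurableTypeR R -> R) : Prop :=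
  [/\ forall n, admissible_pair (G n) (d n),
      convergent R G d,
      exists h : R -> R, euclidean_graphoning mu W h /\
        (fun n => h (1 / (nv (G n))%:R)) ~_\oo (fun n => 1 / (d n)%:R : R)
    & forall F : sgraph, connected_graph F ->
        forall lab : F -> 'I_(nv F), admissible_labeling lab ->
        (hom_density R F (G n) (d n))%:E @[n --> \oo] -->
          graphoning_density I01 lebesgue_measure mu W lab].

Definition h_cube (x : R) : R := if x == 0 then 0 else (ln x^-1 / ln 2)^-1.

Definition h_proj (x : R) : R := Num.sqrt (2 * x).

(* The digit [a 0] is unused. *)
Definition binary (a : nat -> bool) : R :=
  limn (fun n => \sum_(1 <= j < n.+1) (a j)%:R / 2 ^+ j : R).

Definition const_block (a : nat -> bool) (m n : nat) : Prop :=
  forall j k, (m <= j <= n)%N -> (m <= k <= n)%N -> a j = a k.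

Definition S_cube : set R :=
  [set binary a | a in [set a : nat -> bool | const_block a 1 2 /\
     forall i, (1 <= i)%N -> const_block a (2 ^ i + 1) (2 ^ i.+1)]].

Definition S_proj : set R :=
  [set binary a | a in [set a : nat -> bool | const_block a 1 3 /\
     forall i, (2 <= i)%N -> const_block a (2 * i) (2 * i + 1)]].

Definition W_of (S : set R) (x y : measurableTypeR R) : R := \1_S `|x - y|.

End Euclidean.

(* Main.v *)
From Pilot Require Import Defs.
From HB Require Import structures.
From mathcomp Require Import all_boot all_order all_algebra finmap.
From mathcomp Require Import all_classical all_reals all_analysis.
From mathcomp Require Import measurable_realfun lra ring zify.
Import Pilot.Defs.

Set Implicit Arguments.
Unset Strict Implicit.
Unset Printing Implicit Defensive.

Import Order.TTheory GRing.Theory Num.Theory.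
Import numFieldNormedType.Exports.

(** Both halves of the statement come from one mechanism, which uses the graphs
only through [sparse_regular] and the gauge only through [cantor_gauge].

On the side of the graphs, hypercubes and incidence graphs of projective planes
are regular of degree [d], and two distinct vertices have at most two common
neighbours. Embed the vertices of [F] one after the other, so that each vertex
that does not open a new component has an earlier neighbour. In a forest such a
vertex has exactly one, hence exactly [d] possible images, and the density of
[F] is 1. Otherwise some vertex has two earlier neighbours: either these have
distinct images, and at most two positions remain, or they have the same image,
which costs a factor [d] at an earlier step. So the density is at most [3 / d]
([hom_forest], [hom_cyclic]), and the limit is 1 for forests and 0 for the
other graphs.

On the side of the limit, [S] is a Cantor set: an interval of length [r_k]
keeps its two end intervals of length [r_{k+1}], where [r_k = 2^-n_k] and
[n_k] is the end of the [k]-th block of digits. The gauge satisfies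
[h(r_k) = 2^-k], so the obvious covers give [mu(S) <= 1]. Conversely, a short
interval that meets both halves of a basic interval is at least as expensive
as its two parts, by the inequality [cg_split], so no finite cover of [S] by
short intervals costs less than 1, and compactness reduces countable covers to finite
ones ([hausdorff_cantor0]). The Hausdorff premeasures are additive across a
point [a] up to [2 h(eta)], because the cover sets of diameter less than [eta]
that straddle [a] can be replaced by two intervals of length [eta]; this makes
[mu] a measure on the Borel sets ([hausdorff_measure_ex]).

The neighbourhood of [x] is the part of [x + S] and [x - S] in the unit
interval. Since [S] is symmetric about 1/2, these are copies of two parts of [S]
that make up [S] and overlap in at most one point, so all degrees are 1
([nbhd_full]). Measurability of the degrees and reversibility follow from
Tonelli's theorem for the product of Lebesgue measure with the restriction of
[mu] to [S], which is finite although [mu] is not sigma-finite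
([cantor_graphoning]). Two neighbourhoods of [x] and [y] have a null
intersection unless [x - y] is rational: all blocks have length at least 2, so
a difference [t] of two points of [S] has only one signed expansion; each of
its nonzero digits prescribes a digit of the points of [S] that meet [S + t]
and halves the bound for the measure, and there are infinitely many of them
when [t] is irrational ([hausdorff_selfcap]).

In the iterated integral over an admissible labeling of a connected graph, a
vertex with one earlier neighbour contributes a degree, that is 1. A vertex
with two earlier neighbours contributes the measure of the intersection of two
neighbourhoods, which vanishes for all but countably many positions of the
later of the two, and countable sets are [mu]-null. So the density in the
graphoning is 1 for trees and 0 for all other connected graphs, as for the
graphs ([graphoning_density_forest], [graphoning_density_cyclic]). *)

(** * Orders of exploration of a graph *)
Section Exploration.
Variable F : sgraph.
Implicit Types (u v w : F) (lab : F -> 'I_(nv F)).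

Definition back lab v : {set F} := [set u | adj u v && (lab u < lab v)%N].

(** An admissible labeling, generalized to graphs that need not be connected:
a vertex without earlier neighbours must open a new component. *)
Definition exploration lab : Prop := bijective lab /\
  forall v, back lab v != finset.set0 \/
    (forall u, (lab u < lab v)%N -> ~~ connect (@adj F) u v).

Lemma adj_connect_sym : connect_sym (@adj F).
Proof. by apply: sym_connect_sym; exact: adj_sym. Qed.

Let partial_exploration (s : seq F) := uniq s /\
  forall v, v \in s -> (exists u, [/\ u \in s, adj u v & (index u s < index v s)%N]) \/
    (forall u, u \in s -> (index u s < index v s)%N -> ~~ connect (@adj F) u v).

(** Greedily: append a neighbour of the vertices already listed if there is
one; if there is none, they form a union of components, and any other vertex
may be appended. *)
Lemma exploration_exists : exists lab, exploration lab.
Proof.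
have H m : (m <= #|F|)%N -> exists2 s, size s = m & partial_exploration s.
  elim: m => [_|m IH mF]; first by exists [::].
  have [s sm [us gs]] := IH (ltnW mF).
  have ext x : x \notin s -> ((exists2 u, u \in s & adj u x) \/
      (forall u, u \in s -> ~~ connect (@adj F) u x)) ->
      exists2 s, size s = m.+1 & partial_exploration s.
    move=> xs Hx; exists (rcons s x); first by rewrite size_rcons sm.
    have ix : index x (rcons s x) = size s.
      by rewrite -cats1 index_cat (negbTE xs) /= eqxx addn0.
    have iu u : u \in s -> index u (rcons s x) = index u s.
      by move=> us'; rewrite -cats1 index_cat us'.
    split=> [|v]; first by rewrite rcons_uniq xs.
    rewrite mem_rcons inE => /orP[/eqP ->|vs].
      rewrite ix; case: Hx => [[u us' ux]|Hx]; [left|right].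
        by exists u; rewrite mem_rcons inE us' orbT iu// index_mem.
      by move=> u; rewrite mem_rcons inE => /orP[/eqP ->|/Hx//]; rewrite ix ltnn.
    rewrite (iu v vs); case: (gs v vs) => [[u [us' uv iuv]]|Hv]; [left|right].
      by exists u; rewrite mem_rcons inE us' orbT iu.
    move=> u; rewrite mem_rcons inE => /orP[/eqP ->|us' ]; last by rewrite iu//; exact: Hv.
    by rewrite ix ltnNge index_size.
  have [[u v]|] := pickP [pred p : F * F | [&& p.1 \in s, p.2 \notin s & adj p.1 p.2]].
    by move=> /and3P[/= us' vs uv]; apply: (ext v) => //; left; exists u.
  move=> closeds.
  have [x xs] : exists x, x \notin s.
    apply/existsP; rewrite -negb_forall; apply/negP => /forallP Hs.
    have : (#|F| <= size s)%N by rewrite -(card_uniqP us); apply: subset_leq_card;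
      apply/fintype.subsetP.
    by rewrite sm leqNgt mF.
  apply: (ext x) => //; right=> u us'; apply: contra xs => ux.
  have cl : closed_mem (@adj F) (mem s).
    apply: intro_closed; first exact: adj_connect_sym.
    move=> a b ab /= As; apply: contraT => bs.
    by have := closeds (a, b); rewrite /= As bs ab.
  by rewrite -(closed_connect cl ux).
have [s sF [us gs]] := H #|F| (leqnn _).
have mems v : v \in s.
  apply/negPn/negP => vs; have /card_uniqP : uniq (v :: s) by rewrite /= vs.
  by rewrite /= sF; have := max_card (mem (v :: s)) => /[swap] ->; rewrite ltnn.
have is_ v : (index v s < nv F)%N by rewrite /nv -sF index_mem.
exists (fun v => Ordinal (is_ v)); split.
  apply: inj_card_bij; last by rewrite card_ord.
  by move=> u v [] /index_inj -> //.
move=> v; case: (gs v (mems v)) => [[u [_ uv iuv]]|Hv]; [left|right].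
  by apply/finset.set0Pn; exists u; rewrite inE uv.
by move=> u /= uv; exact: Hv.
Qed.

Lemma connected_connect : connected_graph F -> forall u v, connect (@adj F) u v.
Proof.
move=> F1 u v; rewrite -(root_connect adj_connect_sym).
have /eqP/card1P[r Hr] : #|predI (roots (@adj F)) F| = 1%N by exact: F1.
have H x : fingraph.root (@adj F) x = r.
  have := Hr (fingraph.root (@adj F) x); by rewrite !inE (roots_root adj_connect_sym) => /esym/eqP.
by rewrite !H.
Qed.

(** Each component has exactly one vertex without earlier neighbours, the one
with the smallest label. *)
Lemma card_start lab : exploration lab ->
  #|[set v | back lab v == finset.set0]| = nc F.
Proof.
move=> [blab elab]; have labI := bij_inj blab.
rewrite -(@card_in_imset _ _ (fingraph.root (@adj F))).
  rewrite /nc /n_comp_mem; apply: eq_card => r; rewrite !inE andbT.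
  apply/imsetP/idP => [[v _ ->]|rr]; first exact: (roots_root adj_connect_sym).
  have [v rv vmin] := @arg_minnP _ r (connect (@adj F) r) (fun v => nat_of_ord (lab v)) (connect0 _ _).
  exists v; last first.
    by rewrite -(eqP (rr : fingraph.root _ r == r)); apply/esym/eqP;
      rewrite (root_connect adj_connect_sym) adj_connect_sym.
  rewrite inE; apply/eqP/setP => u; rewrite !inE; apply/negbTE/negP => /andP[uv luv].
  have /vmin : connect (@adj F) r u.
    by apply: (connect_trans rv); apply: connect1; rewrite adj_sym.
  by rewrite leqNgt luv.
have key u v : (lab u < lab v)%N -> back lab v == finset.set0 ->
    fingraph.root (@adj F) u <> fingraph.root (@adj F) v.
  move=> uv; case: (elab v) => [/negbTE -> //|/(_ u uv) cuv] _ /eqP.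
  by rewrite (root_connect adj_connect_sym) (negbTE cuv).
move=> u v; rewrite !inE => us vs ruv; apply: labI; apply: val_inj => /=.
by have [uv|vu|//] := ltngtP (lab u) (lab v); [case: (key u v uv vs)|case: (key v u vu us)].
Qed.

End Exploration.

(** In the subgraph induced by the labels up to that of [v], the neighbours of
[v] are its earlier neighbours; if there were none, [v] would be isolated in a
connected graph with at least two vertices. *)
Lemma admissible_exploration (F : sgraph) (lab : F -> 'I_(nv F)) :
  admissible_labeling lab -> exploration lab.
Proof.
move=> [blab alab]; split=> // v.
have [b0|] := eqVneq (back lab v) finset.set0; last by left.
right=> u uv; exfalso.
pose A := [set w : F | (lab w < (lab v).+1)%N].
have uA : u \in A by rewrite inE leqW.
have vA : v \in A by rewrite inE.
have := connected_connect (alab (lab v).+1 (ltn_ord (lab v))) (exist _ v vA) (exist _ u uA).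
move=> /connectP[[|[w wA] p] /= pp lp].
  by have := congr1 val lp => /= uv'; rewrite uv' ltnn in uv.
move: pp {lp} => /andP[vw _]; have : w \in back lab v; last by rewrite b0 inE.
rewrite !inE in wA *; rewrite adj_sym vw /= ltn_neqAle -ltnS wA andbT.
apply/eqP => /val_inj /(bij_inj blab) wv.
by have := vw; rewrite /= wv adj_irr.
Qed.

(** * Homomorphism counts *)
Section HomCount.
Variables (F G : sgraph) (lab : F -> 'I_(nv F)) (d : nat).
Hypothesis Hlab : exploration lab.
Local Notation n := (nv F).
Local Notation N := (nv G).
Implicit Types (f : {ffun F -> G}) (P : pred {ffun F -> G}) (u v x : F) (i : nat).

(** Partial homomorphisms are counted as total maps that respect the edges
between the first vertices and are arbitrary elsewhere, so that all counts are
over the same type. *)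
Let upd f x (y : G) : {ffun F -> G} := [ffun z => if z == x then y else f z].

(** Exchanging the value at [x] with an independent value is an involution. *)
Let sum_upd x (Phi : {ffun F -> G} -> nat) :
  \sum_f \sum_y Phi (upd f x y) = (N * \sum_f Phi f)%N.
Proof.
rewrite pair_big /= (reindex_inj (h := fun p => (upd p.1 x p.2, p.1 x))) /=; last first.
  apply: (can_inj (g := fun p => (upd p.1 x p.2, p.1 x))) => -[f y] /=; congr pair.
    by apply/ffunP => z; rewrite !ffunE; case: eqP => [->|].
  by rewrite ffunE eqxx.
rewrite (eq_bigr (fun p : {ffun F -> G} * G => Phi p.1)) => [|[f y] _] /=; last first.
  by congr Phi; apply/ffunP => z; rewrite !ffunE; case: eqP => [->|].
rewrite -(pair_big xpredT xpredT (fun f _ => Phi f))/= big_distrr/=.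
by apply: eq_bigr => f _; rewrite sum_nat_const.
Qed.

Let hom_below i f := [forall u, forall v, adj u v && (lab u < i)%N && (lab v < i)%N ==> adj (f u) (f v)].

Let fits f x y := [forall u in back lab x, adj (f u) y].

Let count i P := #|[set f | hom_below i f && P f]|.

Let indep P x := forall f y, P (upd f x y) = P f.

Let hom_below_upd i x f y : lab x = i :> nat ->
  hom_below i.+1 (upd f x y) = hom_below i f && fits f x y.
Proof.
move=> xi; have nx u : (lab u < i)%N -> (u == x) = false.
  by move=> ui; apply/eqP => ux; rewrite ux xi ltnn in ui.
apply/forallP/andP => [H|[/forallP H1 /forallP H2] u].
  split; apply/forallP => u.
    apply/forallP => v; apply/implyP => /andP[/andP[uv ui] vi].
    have := H u => /forallP/(_ v); rewrite uv !leqW//= !ffunE.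
    by rewrite !nx.
  apply/implyP; rewrite inE => /andP[ux lu].
  have := H u => /forallP/(_ x); rewrite ux xi leqW -?xi// leqnn !ffunE eqxx.
  by rewrite nx -?xi.
apply/forallP => v; apply/implyP => /andP[/andP[uv ui] vi]; rewrite !ffunE.
have lt w : w != x -> (lab w < i.+1)%N -> (lab w < i)%N.
  move=> wx; rewrite ltnS leq_eqVlt => /orP[/eqP|//]; rewrite -xi => /val_inj.
  by move=> /(bij_inj Hlab.1) wx'; rewrite wx' eqxx in wx.
have [ux|ux] := eqVneq u x; have [vx|vx] := eqVneq v x.
- by rewrite ux vx adj_irr in uv.
- have := H2 v; rewrite inE adj_sym -ux uv ux xi lt//= => ?; by rewrite adj_sym.
- by have := H2 u; rewrite inE -vx uv vx xi lt.
- by have := H1 u => /forallP/(_ v); rewrite uv !lt.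
Qed.

Let count_step i x P : lab x = i :> nat ->
  (N * count i.+1 P = \sum_(f | hom_below i f) #|[set y | fits f x y && P (upd f x y)]|)%N.
Proof.
move=> xi; rewrite /count -sum1_card big_mkcond /= -(sum_upd x) [RHS]big_mkcond /=.
apply: eq_bigr => f _; case: ifP => Hf.
  rewrite -sum1_card [RHS]big_mkcond /=; apply: eq_bigr => y _; rewrite !inE.
  by rewrite (hom_below_upd _ _ xi) Hf.
by rewrite big1// => y _; rewrite !inE (hom_below_upd _ _ xi) Hf.
Qed.

Let count_sum i P : (count i P = \sum_(f | hom_below i f && P f) 1)%N.
Proof. by rewrite sum1_card /count cardsE. Qed.

(** The exponent of [d / N] in the count of the homomorphisms that are defined
on the vertices with labels less than [i]. *)
Let g i := #|[set v | (lab v < i)%N && (back lab v != finset.set0)]|.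

Let gS i x : lab x = i :> nat -> g i.+1 = (g i + (back lab x != finset.set0))%N.
Proof.
move=> xi; rewrite /g (cardsD1 x) inE xi ltnSn /= addnC; congr (_ + _)%N.
apply: eq_card => v; rewrite !inE ltnS leq_eqVlt; have [->|vx] := eqVneq v x.
  by rewrite xi ltnn.
rewrite -xi (_ : (_ == _ :> nat) = false)//; apply/eqP => /val_inj /(bij_inj Hlab.1) vx'.
by rewrite vx' eqxx in vx.
Qed.

Let gn : g n = (n - nc F)%N.
Proof.
rewrite -(card_start Hlab) [in RHS]/nv -[in RHS](cardsC [set v | back lab v == finset.set0]) addKn.
by apply: eq_card => v; rewrite !inE ltn_ord.
Qed.

Hypothesis degG : forall x : G, degree x = d.
Hypothesis N0 : (0 < N)%N.

Let fits_le f x : back lab x != finset.set0 -> (#|[set y | fits f x y]| <= d)%N.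
Proof.
move=> /finset.set0Pn[u ux]; rewrite -(degG (f u)) /degree; apply: subset_leq_card.
by apply/fintype.subsetP => y; rewrite !inE => /forallP/(_ u); rewrite ux.
Qed.

Let fits0 f x y : back lab x = finset.set0 -> fits f x y.
Proof. by move=> b0; apply/forallP => u; rewrite b0 inE. Qed.

Let fits1 f x : #|back lab x| = 1%N -> #|[set y | fits f x y]| = d.
Proof.
move=> /eqP/cards1P[u bu]; rewrite -(degG (f u)) /degree; apply: eq_card => y.
rewrite !inE /fits bu; apply/forallP/idP => [/(_ u)|H v]; first by rewrite inE eqxx.
by rewrite inE; apply/implyP => /eqP ->.
Qed.

Let step_le i x P : lab x = i :> nat -> indep P x ->
  (count i.+1 P * N ^ (back lab x != finset.set0) <= count i P * d ^ (back lab x != finset.set0))%N.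
Proof.
move=> xi iP; have := count_step P xi; case: eqVneq => bx /=.
  rewrite !muln1 => E; rewrite -(leq_pmul2l N0) E count_sum big_distrr /= big_mkcondr.
  apply: leq_sum => f _; under eq_finset do rewrite iP.
  case: (P f); last by rewrite eq_card0// => y; rewrite !inE andbF.
  by rewrite muln1; exact: max_card.
rewrite !expn1 mulnC => ->; rewrite count_sum mulnC big_distrr /= big_mkcondr.
apply: leq_sum => f _; under eq_finset do rewrite iP.
case: (P f); last by rewrite eq_card0// => y; rewrite !inE andbF.
by rewrite muln1; under eq_finset do rewrite andbT; exact: fits_le.
Qed.

Let step_eq i x : lab x = i :> nat -> (#|back lab x| <= 1)%N ->
  (count i.+1 xpredT * N ^ (back lab x != finset.set0) = count i xpredT * d ^ (back lab x != finset.set0))%N.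
Proof.
move=> xi bx1; have := count_step xpredT xi; case: eqVneq => bx /=.
  rewrite !muln1 => E; apply/eqP; rewrite -(eqn_pmul2l N0) E count_sum big_distrr /= big_mkcondr.
  apply/eqP; apply: eq_bigr => f _; rewrite muln1.
  by apply: eq_card => y; rewrite !inE fits0.
rewrite !expn1 mulnC => ->; rewrite count_sum mulnC big_distrr /= big_mkcondr.
apply: eq_bigr => f _; under eq_finset do rewrite andbT.
by rewrite fits1 ?muln1//; apply/eqP; rewrite eqn_leq bx1 card_gt0.
Qed.

Let count0 P : (count 0 P <= N ^ n)%N.
Proof. by apply: leq_trans (max_card _) _; rewrite card_ffun. Qed.

Let count0T : count 0 xpredT = (N ^ n)%N.
Proof.
rewrite /nv -card_ffun; apply: eq_card => f; rewrite !inE andbT.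
by apply/forallP => u; apply/forallP => v; rewrite ltn0 andbF.
Qed.

Let g0 : g 0 = 0%N.
Proof. by apply: eq_card0 => v; rewrite !inE. Qed.

Let at_label i : (i < n)%N -> exists x, lab x = i :> nat.
Proof.
by move=> lin; have [la H1 H2] := Hlab.1; exists (la (Ordinal lin)); rewrite H2.
Qed.

Let countn : count n xpredT = hom F G.
Proof.
apply: eq_card => f; rewrite !inE andbT; apply: eq_forallb => u; apply: eq_forallb => v.
by rewrite !ltn_ord !andbT.
Qed.

Let Nn : (N ^ n = N ^ nc F * N ^ g n)%N.
Proof. by rewrite gn -expnD subnKC// -(card_start Hlab) max_card. Qed.

Lemma hom_forest : (forall v, (#|back lab v| <= 1)%N) ->
  hom F G = (N ^ nc F * d ^ (n - nc F))%N.
Proof.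
move=> b1; have H i : (i <= n)%N -> (count i xpredT * N ^ g i = N ^ n * d ^ g i)%N.
  elim: i => [_|i IH lin]; first by rewrite g0 !muln1 count0T.
  have [x xi] := at_label lin.
  rewrite (gS xi) !expnD [X in (_ * X = _)%N]mulnC mulnA (step_eq xi (b1 x)) mulnAC.
  by rewrite (IH (ltnW lin)) -mulnA.
have := H n (leqnn _); rewrite Nn countn gn mulnAC => /eqP.
by rewrite eqn_pmul2r ?expn_gt0 ?N0// => /eqP.
Qed.

(** Let [u0] come before [w0], both earlier neighbours of [x0]. A homomorphism
has at most two choices at [x0] if the images of [u0] and [w0] differ. The
homomorphisms for which they coincide are fewer by a factor [d], because [w0]
has an earlier neighbour and would otherwise have up to [d] choices. *)
Lemma hom_cyclic : (0 < d)%N ->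
  (forall x y : G, x != y -> #|[set z | adj x z && adj y z]| <= 2)%N ->
  (exists v, (1 < #|back lab v|)%N) ->
  (hom F G * d <= 3 * (N ^ nc F * d ^ (n - nc F)))%N.
Proof.
move=> d0 codeg [x0 /card_gt1P[u0 [w0 [u0x w0x uw0]]]].
wlog luw : u0 w0 u0x w0x uw0 / (lab u0 < lab w0)%N.
  move=> H; have [|/H|/val_inj/(bij_inj Hlab.1) uw] := ltngtP (lab u0) (lab w0); first exact: H.
    by apply; rewrite // eq_sym.
  by rewrite uw eqxx in uw0.
have lwx : (lab w0 < lab x0)%N by move: w0x; rewrite inE => /andP[].
have bw0 : back lab w0 != finset.set0.
  case: (Hlab.2 w0) => // /(_ u0 luw) /negP[].
  move: u0x w0x; rewrite !inE => /andP[ux _] /andP[wx _].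
  by apply: (connect_trans (connect1 ux)); rewrite adj_connect_sym; exact: connect1.
have le0 i : (i <= n)%N -> (count i xpredT * N ^ g i <= N ^ n * d ^ g i)%N.
  elim: i => [_|i IH lin]; first by rewrite g0 !muln1 count0.
  have [x xi] := at_label lin.
  rewrite (gS xi) !expnD [X in (_ * X <= _)%N]mulnC mulnA.
  have E : indep xpredT x by [].
  apply: (leq_trans (leq_mul (step_le xi E) (leqnn _))).
  by rewrite mulnAC mulnA leq_mul2r (IH (ltnW lin)) orbT.
(* [leP] bounds the maps that identify [u0] and [w0]: the gain of a factor [d]
   is made at [w0] and kept afterwards. *)
pose P : pred {ffun F -> G} := fun f => f u0 == f w0.
have iP x : (lab w0 < lab x)%N -> indep P x.
  move=> wx f y; rewrite /P !ffunE.
  have [xw|_] := eqVneq w0 x; first by rewrite xw ltnn in wx.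
  by have [xu|//] := eqVneq u0 x; rewrite -xu ltnNge ltnW in wx.
have leP i : (lab w0 < i <= n)%N -> (count i P * N ^ g i * d <= N ^ n * d ^ g i)%N.
  elim: i => [//|i IH] /andP[]; rewrite ltnS leq_eqVlt => /orP[/eqP wi lin|wi lin].
    rewrite (gS wi) bw0 !expnD !expn1 [X in (_ * X * _ <= _)%N]mulnC mulnA.
    rewrite mulnA leq_mul2r; apply/orP; right.
    apply: leq_trans (le0 i (ltnW lin)); rewrite leq_mul2r; apply/orP; right.
    rewrite mulnC (count_step P wi) count_sum big_mkcond [X in (_ <= X)%N]big_mkcond.
    apply: leq_sum => f _; rewrite andbT; case: ifP => // _.
    apply: (@leq_trans #|[set f u0]|); last by rewrite cards1.
    apply: subset_leq_card.
    apply/fintype.subsetP => y; rewrite !inE /P !ffunE eqxx => /andP[_].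
    by rewrite (negbTE uw0) eq_sym.
  have [x xi] := at_label lin; have wx : (lab w0 < lab x)%N by rewrite xi.
  rewrite (gS xi) !expnD [X in (_ * X * _ <= _)%N]mulnC mulnA -[X in (X <= _)%N]mulnA.
  apply: (leq_trans (leq_mul (step_le xi (iP _ wx)) (leqnn _))).
  have IHi := IH (introT andP (conj wi (ltnW lin))).
  set b := nat_of_bool _.
  have -> : (count i P * d ^ b * (N ^ g i * d) = count i P * N ^ g i * d * d ^ b)%N by ring.
  by rewrite mulnA leq_mul2r IHi orbT.
(* The constant is 2 for the maps that separate [u0] and [w0], plus 1 for those
   that identify them. *)
have le3 i : (lab x0 < i <= n)%N -> (count i xpredT * N ^ g i * d <= 3 * (N ^ n * d ^ g i))%N.
  elim: i => [//|i IH] /andP[]; rewrite ltnS leq_eqVlt => /orP[/eqP xi lin|xi lin].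
    have bx0 : back lab x0 != finset.set0 by apply/finset.set0Pn; exists u0.
    rewrite (gS xi) bx0 !expnD !expn1 [X in (_ * X * _ <= _)%N]mulnC mulnA.
    have c2 : (count i.+1 xpredT * N <= 2 * count i xpredT + d * count i P)%N.
      rewrite mulnC (count_step _ xi).
      have -> : (2 * count i xpredT + d * count i P =
          \sum_(f | hom_below i f) (2 + if P f then d else 0))%N.
        rewrite big_split /= !count_sum !big_distrr /=; congr (_ + _)%N.
          by apply: eq_big => f; rewrite ?andbT ?muln1.
        by rewrite big_mkcondr; apply: eq_bigr => f _; rewrite muln1.
      apply: leq_sum => f _; under eq_finset do rewrite andbT.
      case: ifP => Pf; first by rewrite (leq_trans (fits_le _ bx0))// leq_addl.
      rewrite addn0; apply: leq_trans (codeg (f u0) (f w0) (negbT Pf)).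
      apply: subset_leq_card; apply/fintype.subsetP => y; rewrite !inE => /forallP H.
      by have := H u0; have := H w0; rewrite u0x w0x /= => -> ->.
    have A := le0 i (ltnW lin); have B : (count i P * N ^ g i * d <= N ^ n * d ^ g i)%N.
      by apply: leP; rewrite -xi lwx ltnW.
    apply: (@leq_trans ((2 * count i xpredT + d * count i P) * N ^ g i * d)).
      by rewrite !leq_mul2r c2 !orbT.
    have -> : ((2 * count i xpredT + d * count i P) * N ^ g i * d =
      2 * (count i xpredT * N ^ g i * d) + count i P * N ^ g i * d * d)%N by ring.
    have -> : (3 * (N ^ n * (d ^ g i * d)) = 2 * (N ^ n * d ^ g i * d) + N ^ n * d ^ g i * d)%N by ring.
    by apply: leq_add; rewrite ?leq_mul2l leq_mul2r ?A ?B !orbT.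
  have [x xi'] := at_label lin.
  rewrite (gS xi') !expnD [X in (_ * X * _ <= _)%N]mulnC mulnA -[X in (X <= _)%N]mulnA.
  have E : indep xpredT x by [].
  apply: (leq_trans (leq_mul (step_le xi' E) (leqnn _))).
  have IHi := IH (introT andP (conj xi (ltnW lin))).
  set b := nat_of_bool _.
  have -> : (count i xpredT * d ^ b * (N ^ g i * d) = count i xpredT * N ^ g i * d * d ^ b)%N by ring.
  have -> : (3 * (N ^ n * (d ^ g i * d ^ b)) = 3 * (N ^ n * d ^ g i) * d ^ b)%N by ring.
  by rewrite leq_mul2r IHi orbT.
have := le3 n; rewrite ltn_ord leqnn => /(_ isT); rewrite Nn countn gn.
have -> : (hom F G * N ^ (n - nc F) * d = hom F G * d * N ^ (n - nc F))%N by ring.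
have -> : (3 * (N ^ nc F * N ^ (n - nc F) * d ^ (n - nc F)) =
  3 * (N ^ nc F * d ^ (n - nc F)) * N ^ (n - nc F))%N by ring.
by rewrite leq_pmul2r// expn_gt0 N0.
Qed.

End HomCount.

(** * Hypercubes and incidence graphs *)
Definition sparse_regular (G : sgraph) (d : nat) : Prop :=
  [/\ (0 < d)%N, (0 < nv G)%N, forall x : G, degree x = d &
    forall x y : G, x != y -> (#|[set z : G | adj x z && adj y z]| <= 2)%N].

Section HypercubeGraph.
Variable d : nat.
Implicit Types (f g : hypercube d) (i : 'I_d).

Definition flip f i : hypercube d := [ffun j => if j == i then ~~ f j else f j].

Lemma flip_inj f : injective (flip f).
Proof.
move=> i j /ffunP/(_ i); rewrite !ffunE eqxx; case: eqP => //.
by case: (f i).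
Qed.

Lemma hypercube_adjP f g : reflect (exists i, g = flip f i) (adj f g).
Proof.
apply: (iffP cards1P) => [[i fgi]|[i ->]]; exists i.
  apply/ffunP => j; have := congr1 (fun A : {set _} => j \in A) fgi.
  by rewrite !inE ffunE; case: (j == i); case: (f j); case: (g j).
by apply/setP => j; rewrite !inE ffunE; case: (j == i); case: (f j).
Qed.

Lemma degree_hypercube f : degree f = d.
Proof.
rewrite -[RHS]card_ord -(card_imset xpredT (@flip_inj f)); apply: eq_card => g.
rewrite !inE; apply/hypercube_adjP/imsetP => [[i ->]|[i _ ->]]; by exists i.
Qed.

(** At a coordinate where [f] and [g] differ, a common neighbour differs from
one of them, and so arises from that one by flipping this very coordinate. *)
Lemma codegree_hypercube f g : f != g ->
  (#|[set z : hypercube d | adj f z && adj g z]| <= 2)%N.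
Proof.
move=> fg; have [i0 fgi] : exists i, f i != g i.
  by apply/existsP; rewrite -negb_forall; apply: contra fg => /forallP H; apply/eqP/ffunP => i;
    apply/eqP.
apply: (@leq_trans #|[set flip f i0; flip g i0]|); last by rewrite cards2 ltnS leq_b1.
apply: subset_leq_card; apply/fintype.subsetP => z; rewrite !inE.
move=> /andP[/hypercube_adjP[i zi] /hypercube_adjP[j zj]]; apply/orP.
have [ii|/negbTE ni] := eqVneq i0 i; first by left; rewrite zi ii.
have [jj|/negbTE nj] := eqVneq i0 j; first by right; rewrite zj jj.
have zf : z i0 = f i0 by rewrite zi ffunE ni.
have zg : z i0 = g i0 by rewrite zj ffunE nj.
by rewrite -zf -zg eqxx in fgi.
Qed.

Lemma nv_hypercube : nv (hypercube d) = (2 ^ d)%N.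
Proof. by rewrite /nv card_ffun card_bool card_ord. Qed.

End HypercubeGraph.

Lemma hypercube_sparse_regular d : sparse_regular (hypercube d.+1) d.+1.
Proof.
split=> //; first by rewrite nv_hypercube expn_gt0.
- exact: degree_hypercube.
- exact: codegree_hypercube.
Qed.

Section ProjectivePlane.
Variables (P L : finType) (inc : P -> L -> bool) (q : nat).
Hypothesis pp : projective_plane inc q.
Implicit Types (x y p : P) (l m : L).

Let card_join x y : x != y -> #|[set l | inc x l && inc y l]| = 1%N.
Proof.
move=> /(plane_line pp)[l [xyl lu]]; apply/eqP/cards1P; exists l.
by apply/setP => m; rewrite !inE; apply/idP/eqP => [/lu|->].
Qed.

Let card_meet l m : l != m -> #|[set x | inc x l && inc x m]| = 1%N.
Proof.
move=> /(plane_point pp)[x [xlm xu]]; apply/eqP/cards1P; exists x.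
by apply/setP => y; rewrite !inE; apply/idP/eqP => [/xu|->].
Qed.

Let card_count (T : finType) (A : pred T) : #|[set a | A a]| = \sum_(a : T) A a.
Proof. by rewrite -sum1_card big_mkcond /=; apply: eq_bigr => a _; rewrite inE;
  case: (A a). Qed.

(** If all lines passed through [p], all points would lie on one line, against
the existence of a quadrangle. *)
Let line_avoiding p : exists l, ~~ inc p l.
Proof.
apply/existsP; rewrite -negb_forall; apply/negP => /forallP pl.
have [s [s4 us s2]] := plane_quadrangle pp.
have [a as_ ap] : exists2 a, a \in s & a != p.
  case: s s4 us {s2} => [|a [|b s]] //= _ /andP[abs _].
  have [ap|] := eqVneq a p; last by exists a; rewrite ?mem_head.
  exists b; first by rewrite !inE eqxx orbT.
  by apply: contraNneq abs => bp; rewrite inE ap bp eqxx.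
have [l [apl lu]] := plane_line pp ap.
have all_l x : inc x l.
  have [->|xa] := eqVneq x a; first by case/andP: apl.
  have [m [/andP[xm am] _]] := plane_line pp xa.
  by rewrite (lu m) ?am ?pl.
by have := s2 l; rewrite (eq_count (a2 := xpredT)) ?count_predT ?s4// => x; rewrite /= all_l.
Qed.

(** Double counting of the incidences between the lines through [p] and the
points of a line that avoids [p]. *)
Lemma card_lines_through p : #|[set l | inc p l]| = q.+1.
Proof.
have [l0 pl0] := line_avoiding p.
rewrite -(plane_order pp l0) -!sum1_card.
transitivity (\sum_(l in [set l | inc p l]) \sum_(x in [set x | inc x l0]) inc x l).
  apply: eq_bigr => l; rewrite inE => pl.
  have ll0 : l0 != l by apply: contraNneq pl0 => ->.
  rewrite -(card_meet ll0) card_count [RHS]big_mkcond; apply: eq_bigr => x _.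
  by rewrite inE; case: (inc x l0).
rewrite exchange_big; apply: eq_bigr => x; rewrite inE => xl0 /=.
have px : p != x by apply: contraNneq pl0 => ->.
rewrite -(card_join px) card_count big_mkcond; apply: eq_bigr => l _.
by rewrite inE; case: (inc p l).
Qed.

(** Double counting of the incidences between the lines through [p] and all
points. *)
Lemma card_points : #|P| = (q * q + q + 1)%N.
Proof.
have [p _] : exists p : P, true.
  by have [[|p s] [//]] := plane_quadrangle pp; exists p.
have E : \sum_(l in [set l | inc p l]) #|[set x | inc x l]| = (q.+1 * q.+1)%N.
  by rewrite (eq_bigr (fun=> q.+1)) => [|l _];
    [rewrite sum_nat_const card_lines_through|exact: plane_order pp l].
have : \sum_(l in [set l | inc p l]) #|[set x | inc x l]| = \sum_(x : P) #|[set l | inc p l && inc x l]|.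
  rewrite (eq_bigr (fun l => \sum_(x : P) inc x l)) => [|l _]; last exact: card_count.
  rewrite exchange_big; apply: eq_bigr => x _; rewrite card_count big_mkcond.
  by apply: eq_bigr => l _; rewrite inE; case: (inc p l).
rewrite E (bigD1 p)//= (eq_bigr (fun=> 1%N)) => [|x xp]; last by rewrite card_join// eq_sym.
have -> : \sum_(x | x != p) 1 = #|P|.-1 by rewrite sum1_card -(cardC1 p); apply: eq_card.
rewrite (eq_card (B := [set l | inc p l])); last by move=> l; rewrite !inE andbb.
rewrite card_lines_through; have : (0 < #|P|)%N by apply/card_gt0P; exists p.
by move: #|P| => k; rewrite mulSn mulnS; lia.
Qed.

Lemma card_lines : #|L| = #|P|.
Proof.
have : \sum_(l : L) #|[set x | inc x l]| = \sum_(x : P) #|[set l | inc x l]|.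
  rewrite (eq_bigr (fun l => \sum_(x : P) inc x l)) => [|l _]; last exact: card_count.
  by rewrite exchange_big; apply: eq_bigr => x _; rewrite card_count.
rewrite (eq_bigr (fun=> q.+1)) => [|l _]; last exact: plane_order pp l.
rewrite [RHS](eq_bigr (fun=> q.+1)) => [|x _]; last exact: card_lines_through.
by rewrite !sum_nat_const => /eqP; rewrite eqn_pmul2r// => /eqP.
Qed.

Lemma nv_incidence_graph : nv (incidence_graph inc) = (2 * (q * q + q + 1))%N.
Proof. by rewrite /nv fintype.card_sum card_lines card_points addnn mul2n. Qed.

Lemma incidence_sparse_regular : sparse_regular (incidence_graph inc) q.+1.
Proof.
split=> //; first by rewrite nv_incidence_graph; lia.
- case=> [x|l].
    rewrite -(card_lines_through x) -(card_imset _ (@inr_inj P L)); apply: eq_card => -[y|l];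
      rewrite !inE /=.
      by apply/esym/negbTE/imsetP => -[].
    by apply/idP/imsetP => [xl|[m + [->]]]; [exists l; rewrite ?inE|rewrite inE].
  rewrite -(plane_order pp l) -(card_imset _ (@inl_inj P L)); apply: eq_card => -[x|m];
    rewrite !inE /=.
    by apply/idP/imsetP => [xl|[y + [->]]]; [exists x; rewrite ?inE|rewrite inE].
  by apply/esym/negbTE/imsetP => -[].
- case=> [x|l] [y|m] uv.
  + have xy : x != y by apply: contra uv => /eqP ->.
    apply: (@leq_trans #|[set (inr l : P + L) | l in [set l | inc x l && inc y l]]|).
      apply: subset_leq_card; apply/fintype.subsetP => -[z|l]; rewrite !inE //= => xyl.
      by apply/imsetP; exists l; rewrite ?inE.
    by rewrite card_imset ?card_join//; exact: inr_inj.
  + by rewrite eq_card0// => -[z|k]; rewrite !inE /= ?andbF.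
  + by rewrite eq_card0// => -[z|k]; rewrite !inE /= ?andbF.
  + have lm : l != m by apply: contra uv => /eqP ->.
    apply: (@leq_trans #|[set (inl x : P + L) | x in [set x | inc x l && inc x m]]|).
      apply: subset_leq_card; apply/fintype.subsetP => -[z|k]; rewrite !inE //= => xyl.
      by apply/imsetP; exists z; rewrite ?inE.
    by rewrite card_imset ?card_meet//; exact: inl_inj.
Qed.

End ProjectivePlane.

Local Open Scope classical_set_scope.
Local Open Scope ring_scope.

(** * Hausdorff measures on the unit interval *)
Section HausdorffMeasure.
Variable R : realType.
Implicit Types (A B E : set R) (x y a : R).

Lemma diam_ub A x y : A `<=` `[0, 1] -> A x -> A y -> `|x - y| <= diam A.
Proof.
move=> A01 Ax Ay; apply: ub_le_sup; last by exists x => //; exists y.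
exists 1 => _ [u Au] [v Av] <-.
have /= := A01 _ Au; have /= := A01 _ Av; rewrite !in_itv /=.
by move=> /andP[? ?] /andP[? ?]; rewrite ler_norml; lra.
Qed.

Lemma diam_le A c : 0 <= c -> (forall x y, A x -> A y -> `|x - y| <= c) ->
  diam A <= c.
Proof.
move=> c0 Ac; have [[x Ax]|A0] := pselect (A !=set0).
  by apply: ge_sup; [exists `|x - x|, x => //; exists x | move=> _ [u Au] [v Av] <-; exact: Ac].
rewrite /diam (_ : [set _ | _ in _ & _ in _] = set0) ?sup0//.
by apply/seteqP; split=> // z [u Au]; case: A0; exists u.
Qed.

Lemma diam_ge0 A : 0 <= diam A.
Proof.
have [hs|/sup_out Hs] := pselect (has_sup [set `|x - y| | x in A & y in A]).
  case: (hs) => -[z Hz] _; have := sup_upper_bound hs Hz; apply: le_trans.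
  by case: Hz => u _ [v _ <-]; exact: normr_ge0.
by rewrite /diam Hs.
Qed.

Lemma diam0 : diam (@set0 R) = 0.
Proof. by apply/eqP; rewrite eq_le diam_ge0 andbT; apply: diam_le. Qed.

Variable h : R -> R.
Hypothesis h0 : h 0 = 0.
Hypothesis h_mono : forall x y, 0 <= x -> x <= y -> y < 1 -> h x <= h y.
Hypothesis h_cvg0 : h x @[x --> 0^'+] --> 0.

Let h_ge0 x : 0 <= x -> x < 1 -> 0 <= h x.
Proof. by move=> x0 x1; rewrite -h0; exact: h_mono. Qed.

(** The premeasure of a given size is an outer measure generated by covers with
sets of the sigma-algebra of all sets, where too large sets have infinite
cost; this provides its countable subadditivity. *)
Let D := g_sigma_algebraType (setT : set (set R)).

Let cost (delta : R) (A : set D) : \bar R :=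
  if `[< A `<=` `[0, 1] /\ diam A < delta >] then (h (diam A))%:E else +oo%E.

Let cost0 delta : 0 < delta -> cost delta set0 = 0%E.
Proof. by move=> d0; rewrite /cost asboolT diam0 ?h0//; split=> //; exact: sub0set. Qed.

Let cost_ge0 delta : delta <= 1 -> forall A, (0 <= cost delta A)%E.
Proof.
move=> d1 A; rewrite /cost; case: asboolP => // -[_ dA].
by rewrite lee_fin h_ge0 ?diam_ge0// (lt_le_trans dA).
Qed.

Let hausdorff_preE delta B : 0 < delta <= 1 ->
  hausdorff_pre h delta B = mu_ext (cost delta) B.
Proof.
move=> /andP[d0 d1]; apply/eqP; rewrite eq_le; apply/andP; split.
  apply: le_ereal_inf_tmp => _ [F [_ BF] <-].
  have [[i Fi]|Hn] := pselect (exists i, cost delta (F i) = +oo%E).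
    rewrite (eseries_pinfty _ _ Fi) ?leey// => n _.
    by rewrite -ltNye (lt_le_trans _ (cost_ge0 d1 (F n))).
  have {}Hn i : F i `<=` `[0, 1] /\ diam (F i) < delta.
    apply: contrapT => Hi; apply: Hn; exists i.
    by rewrite /cost asboolF.
  apply: ereal_inf_lbound; exists F => //.
  by apply: eq_eseriesr => i _; rewrite /cost asboolT.
apply: le_ereal_inf_tmp => _ [F [HF BF] <-].
apply: ereal_inf_lbound; exists F.
  by split=> // i; exact: sub_sigma_algebra.
by apply: eq_eseriesr => i _; rewrite /cost asboolT.
Qed.

Lemma hausdorff_pre_ge0 delta B : 0 < delta <= 1 -> (0 <= hausdorff_pre h delta B)%E.
Proof.
move=> d; rewrite hausdorff_preE//; apply: mu_ext_ge0; apply: cost_ge0.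
by case/andP: d.
Qed.

Lemma hausdorff_pre0 delta : 0 < delta <= 1 -> hausdorff_pre h delta set0 = 0%E.
Proof.
move=> /[dup] /andP[d0 d1] d; rewrite hausdorff_preE//; apply: mu_ext0.
  exact: cost0.
exact: cost_ge0.
Qed.

Lemma le_hausdorff_pre delta A B : A `<=` B ->
  (hausdorff_pre h delta A <= hausdorff_pre h delta B)%E.
Proof.
move=> AB; apply: ereal_inf_le_tmp => _ [I [I1 I2] <-]; exists I => //.
by split=> //; exact: subset_trans I2.
Qed.

Lemma hausdorff_pre_delta delta delta' B : delta <= delta' ->
  (hausdorff_pre h delta' B <= hausdorff_pre h delta B)%E.
Proof.
move=> dd; apply: ereal_inf_le_tmp => _ [I [I1 I2] <-]; exists I => //.
split=> // i; split; first exact: (I1 i).1.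
exact: lt_le_trans (I1 i).2 dd.
Qed.

Lemma hausdorff_pre_sigma_subadditive delta (F : (set R)^nat) :
  0 < delta <= 1 -> (hausdorff_pre h delta (\bigcup_n F n) <=
    \sum_(i <oo) hausdorff_pre h delta (F i))%E.
Proof.
move=> /[dup] /andP[d0 d1] d; under eq_eseriesr do rewrite hausdorff_preE//.
rewrite hausdorff_preE//.
exact: (@mu_ext_sigma_subadditive _ D R (cost delta) (cost_ge0 d1) F).
Qed.

Lemma hausdorff_preU delta A B : 0 < delta <= 1 ->
  (hausdorff_pre h delta (A `|` B) <=
    hausdorff_pre h delta A + hausdorff_pre h delta B)%E.
Proof.
move=> d; rewrite -bigcup2E.
apply: le_trans (hausdorff_pre_sigma_subadditive _ d) _.
rewrite (nneseries_split _ 2); last by move=> k _; exact: hausdorff_pre_ge0.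
rewrite eseries0 ?adde0; last first.
  by move=> [|[|k]]// _ _; exact: hausdorff_pre0.
by rewrite !big_nat_recl// big_geq// adde0.
Qed.

Lemma hausdorff_cvg B :
  hausdorff_pre h delta B @[delta --> 0^'+] -->
  ereal_sup ((hausdorff_pre h ^~ B) @` [set` `]0, 1[]).
Proof.
apply: (@nonincreasing_at_right_cvge _ _ 0 (BLeft 1)); first by rewrite bnd_simp.
by move=> x y _ _ xy; exact: hausdorff_pre_delta.
Qed.

Lemma hausdorffE B :
  hausdorff h B = ereal_sup ((hausdorff_pre h ^~ B) @` [set` `]0, 1[]).
Proof. by apply/cvg_lim => //; exact: hausdorff_cvg. Qed.

Lemma hausdorff_ge_pre delta B : 0 < delta ->
  (hausdorff_pre h delta B <= hausdorff h B)%E.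
Proof.
move=> d0; rewrite hausdorffE.
apply: (@le_trans _ _ (hausdorff_pre h (Num.min delta 2^-1) B)).
  by apply: hausdorff_pre_delta; rewrite ge_min lexx.
apply: ereal_sup_ubound; exists (Num.min delta 2^-1) => //=.
by rewrite in_itv /= lt_min d0 invr_gt0 ltr0n gt_min invf_lt1 ?ltr0n// ltr1n orbT.
Qed.

Lemma hausdorff_le e B c : 0 < e ->
  (forall delta, 0 < delta < e -> delta < 1 -> (hausdorff_pre h delta B <= c)%E) ->
  (hausdorff h B <= c)%E.
Proof.
move=> e0 Hc; rewrite hausdorffE; apply: ge_ereal_sup => _ [d /= + <-].
rewrite in_itv /= => /andP[d0 d1].
apply: (@le_trans _ _ (hausdorff_pre h (Num.min d (e / 2)) B)).
  by apply: hausdorff_pre_delta; rewrite ge_min lexx.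
apply: Hc; rewrite ?lt_min ?gt_min ?d0 ?d1 ?divr_gt0//=.
by apply/orP; right; lra.
Qed.

Lemma hausdorff_set0 : hausdorff h set0 = 0%E.
Proof.
apply/eqP; rewrite eq_le; apply/andP; split.
  by apply: (@hausdorff_le 1) => // d /andP[d0 _] d1; rewrite hausdorff_pre0// d0 ltW.
apply: le_trans (hausdorff_ge_pre _ (@ltr01 R)).
by rewrite hausdorff_pre_ge0// ltr01 lexx.
Qed.

Lemma hausdorff_ge0 B : (0 <= hausdorff h B)%E.
Proof.
apply: le_trans (hausdorff_ge_pre _ (@ltr01 R)).
by rewrite hausdorff_pre_ge0// ltr01 lexx.
Qed.

Lemma le_hausdorff A B : A `<=` B -> (hausdorff h A <= hausdorff h B)%E.
Proof.
move=> AB; apply: (@hausdorff_le 1) => // d /andP[d0 _] d1.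
by apply: le_trans (hausdorff_ge_pre B d0); exact: le_hausdorff_pre.
Qed.

Lemma hausdorff_sigma_subadditive : sigma_subadditive (hausdorff h : set R -> \bar R).
Proof.
move=> F; apply: (@hausdorff_le 1) => // d /andP[d0 _] d1.
apply: (le_trans (hausdorff_pre_sigma_subadditive _ _)); first by rewrite d0 ltW.
apply: lee_nneseries => n *; first by apply: hausdorff_pre_ge0; rewrite d0 ltW.
exact: hausdorff_ge_pre.
Qed.

HB.instance Definition _ := isOuterMeasure.Build R R (hausdorff h : set R -> \bar R)
  hausdorff_set0 hausdorff_ge0 le_hausdorff hausdorff_sigma_subadditive.

Lemma hausdorff_pre_single delta A c : 0 < delta <= 1 -> A `<=` `[0, 1] ->
  0 <= c < delta -> (forall x y, A x -> A y -> `|x - y| <= c) ->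
  (hausdorff_pre h delta A <= (h c)%:E)%E.
Proof.
move=> /andP[d0 d1] A01 /andP[c0 cd] Ac.
have dA : diam A <= c by exact: diam_le.
apply: (@le_trans _ _ (h (diam A))%:E); last first.
  by rewrite lee_fin h_mono ?diam_ge0// (lt_le_trans cd).
apply: ereal_inf_lbound; exists (fun n => if n is 0%N then A else set0).
  split; last by move=> x Ax; exists 0%N.
  case=> [|n]; first by split=> //; exact: le_lt_trans cd.
  by split; [exact: sub0set|rewrite diam0].
rewrite nneseries_recl//=.
  by rewrite eseries0 ?adde0// => -[|k]// _ _; rewrite diam0 h0.
by case=> [|k] _ //=; rewrite lee_fin ?diam0 ?h0// h_ge0 ?diam_ge0// (le_lt_trans dA)// (lt_le_trans cd).
Qed.

Lemma hausdorff1 x : 0 <= x <= 1 -> hausdorff h [set x] = 0%E.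
Proof.
move=> x01; apply/eqP; rewrite eq_le hausdorff_ge0 andbT.
apply: (@hausdorff_le 1) => // d /andP[d0 _] d1; rewrite -[leRHS]/((0:R)%:E) -h0.
apply: hausdorff_pre_single; rewrite ?d0 ?lexx ?ltW//.
  by move=> _ ->; rewrite /= in_itv.
by move=> _ _ -> ->; rewrite subrr normr0.
Qed.

(** The map may send parts of the cover outside of the unit interval, hence the
intersection with it. *)
Lemma hausdorff_pre_lipschitz delta (f : R -> R) A B : 0 < delta <= 1 ->
  B `<=` `[0, 1] -> B `<=` f @` A ->
  (forall x y, `|f x - f y| <= `|x - y|) ->
  (hausdorff_pre h delta B <= hausdorff_pre h delta A)%E.
Proof.
move=> /andP[d0 d1] B01 BfA fl; apply: le_ereal_inf_tmp => _ [I [I1 I2] <-].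
have dI i : diam (f @` I i `&` `[0, 1]) <= diam (I i).
  apply: diam_le; first exact: diam_ge0.
  move=> _ _ [[x Ix <-] _] [[y Iy <-] _]; apply: le_trans (fl x y) _.
  by apply: diam_ub => //; exact: (I1 i).1.
apply: (@le_trans _ _ (\sum_(0 <= i <oo) (h (diam (f @` I i `&` `[0, 1])))%:E)%E).
  apply: ereal_inf_lbound; exists (fun i => f @` I i `&` `[0, 1]) => //; split.
    move=> i; split; first exact: subIsetr.
    exact: le_lt_trans (dI i) (I1 i).2.
  move=> y By; have [x Ax fxy] := BfA _ By; have [i _ Ii] := I2 _ Ax.
  by exists i => //; split; [exists x | exact: B01].
apply: lee_nneseries => i _.
  rewrite lee_fin h_ge0 ?diam_ge0//; apply: le_lt_trans (dI i) _.
  exact: lt_le_trans (I1 i).2 d1.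
rewrite lee_fin h_mono ?diam_ge0//.
exact: lt_le_trans (I1 i).2 d1.
Qed.

Lemma hausdorff_lipschitz (f : R -> R) A B : B `<=` `[0, 1] -> B `<=` f @` A ->
  (forall x y, `|f x - f y| <= `|x - y|) -> (hausdorff h B <= hausdorff h A)%E.
Proof.
move=> B01 BfA fl; apply: (@hausdorff_le 1) => // d /andP[d0 _] d1.
apply: le_trans (hausdorff_ge_pre A d0).
by apply: (hausdorff_pre_lipschitz _ _ BfA) => //; rewrite d0 ltW.
Qed.

(** The sets of a cover that meet both sides of [a] lie within distance [eta]
of [a]. On each side their parts are covered by one interval of length [eta],
which costs at most [h eta]. *)
Lemma hausdorff_pre_cut a eta delta E : 0 < eta -> eta < delta -> delta <= 1 ->
  (hausdorff_pre h delta (E `&` `]a, +oo[) +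
   hausdorff_pre h delta (E `&` ~` `]a, +oo[) <=
   hausdorff_pre h eta E + (h eta + h eta)%:E)%E.
Proof.
move=> e0 ed d1; have d01 : 0 < delta <= 1 by rewrite (lt_trans e0 ed).
have he0 : 0 <= h eta by rewrite h_ge0 ?ltW// (lt_le_trans ed).
rewrite -leeBlDr//; apply: le_ereal_inf_tmp => _ [I [I1 I2] <-].
rewrite leeBlDr//.
pose L := [set x : R | x <= a]; pose U := [set x : R | a < x].
have ELU : E `&` `]a, +oo[ = E `&` U.
  by apply/seteqP; split=> x /=; rewrite in_itv/= andbT.
have ELL : E `&` ~` `]a, +oo[ = E `&` L.
  by congr (_ `&` _); apply/seteqP; split=> x;
    rewrite /L/= in_itv/= andbT [x <= a]leNgt => /negP.
rewrite ELU ELL {ELU ELL}.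
have hI i : (0 <= (h (diam (I i)))%:E)%E.
  by rewrite lee_fin h_ge0 ?diam_ge0// (lt_trans (I1 i).2)// (lt_le_trans ed).
have key (V : set R) : (forall x, V x -> forall y, ~ V y -> `|x - a| <= `|x - y|) ->
    (forall x y, V x -> V y -> `|x - a| <= eta -> `|y - a| <= eta -> `|x - y| <= eta) ->
    (hausdorff_pre h delta (E `&` V) <= (h eta)%:E +
      \sum_(i <oo) (if `[< I i `<=` V >] then (h (diam (I i)))%:E else 0))%E.
  move=> V1 V2.
  pose J n := if n is m.+1 then if `[< I m `<=` V >] then I m else set0
              else [set x | V x /\ `|x - a| <= eta /\ 0 <= x <= 1].
  apply: (@le_trans _ _ (\sum_(i <oo) (h (diam (J i)))%:E)%E).
    apply: ereal_inf_lbound; exists J => //; split.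
      case=> [|n] /=; last first.
        case: asboolP => _; last first.
          by split; [exact: sub0set|rewrite diam0 (lt_trans e0 ed)].
        by split; [exact: (I1 n).1|exact: lt_trans (I1 n).2 ed].
      split; first by move=> x [_ [_ ?]]; rewrite /= in_itv.
      apply: le_lt_trans ed; apply: diam_le; first exact: ltW.
      by move=> x y [Vx [xa _]] [Vy [ya _]]; exact: V2.
    move=> x [Ex Vx]; have [i _ Ii] := I2 _ Ex.
    have [IV|/existsNP[y /not_implyP[Iy Vy]]] := pselect (I i `<=` V).
      by exists i.+1 => //=; rewrite asboolT.
    exists 0%N => //=; split=> //; split.
      apply: le_trans (V1 _ Vx _ Vy) _; apply: (@le_trans _ _ (diam (I i))).
        by apply: diam_ub => //; exact: (I1 i).1.
      exact: ltW (I1 i).2.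
    by have := (I1 i).1 _ Ii; rewrite /= in_itv.
  have dJ0 : diam (J 0%N) <= eta.
    by apply: diam_le; [exact: ltW|move=> x y [Vx [xa _]] [Vy [ya _]]; exact: V2].
  have hJ i : (0 <= (h (diam (J i.+1)))%:E)%E.
    by rewrite /=; case: asboolP => // _; rewrite diam0 h0.
  have hJ' i : (0 <= (h (diam (J i)))%:E)%E.
    case: i => [|i]; last exact: hJ.
    by rewrite lee_fin h_ge0 ?diam_ge0// (le_lt_trans dJ0)// (lt_le_trans ed).
  rewrite nneseries_recl//.
  apply: leeD.
    by rewrite lee_fin h_mono ?diam_ge0// (lt_le_trans ed).
  rewrite -(nneseries_addn 1)//.
  apply: lee_nneseries => i *; rewrite addn1; first exact: hJ.
  by rewrite /=; case: asboolP => // _; rewrite diam0 h0.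
have kU : (hausdorff_pre h delta (E `&` U) <= (h eta)%:E +
    \sum_(i <oo) (if `[< I i `<=` U >] then (h (diam (I i)))%:E else 0))%E.
  apply: key => [x + y|x y]; rewrite /U /L /=; last first.
    by move=> ax ay; rewrite !ler_norml => /andP[? ?] /andP[? ?]; lra.
  move=> ax /negP; rewrite -leNgt => ya; rewrite !gtr0_norm ?subr_gt0// ?lerD2l ?lerN2//.
  exact: le_lt_trans ax.
have kL : (hausdorff_pre h delta (E `&` L) <= (h eta)%:E +
    \sum_(i <oo) (if `[< I i `<=` L >] then (h (diam (I i)))%:E else 0))%E.
  apply: key => [x + y|x y]; rewrite /U /L /=; last first.
    by move=> ax ay; rewrite !ler_norml => /andP[? ?] /andP[? ?]; lra.
  move=> ax /negP; rewrite -ltNge => ya; rewrite !ler0_norm ?subr_le0//; first by lra.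
  by rewrite (le_trans ax)// ltW.
apply: le_trans (leeD kU kL) _; rewrite EFinD addeACA addeC leeD2r//.
rewrite -nneseriesD; last 2 first.
  by move=> i _ _; case: ifPn.
  by move=> i _ _; case: ifPn.
apply: lee_nneseries => i *; first by case: ifPn; case: ifPn => *;
  rewrite ?adde0 ?add0e ?adde_ge0.
case: asboolP => IU; case: asboolP => IL; rewrite ?adde0 ?add0e//.
rewrite [I i](_ : _ = set0) ?diam0 ?h0 ?adde0//.
by apply/seteqP; split=> // x Ix; have := IU _ Ix; have := IL _ Ix;
  rewrite /L/U/= leNgt => /negP.
Qed.

(** As [eta] tends to 0, so does the cost of cutting at [a]. *)
Lemma hausdorff_ray_caratheodory a : (hausdorff h).-caratheodory `]a, +oo[.
Proof.
apply: le_caratheodory_measurable => E; rewrite -[leRHS]/(hausdorff h E).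
have c1 := @hausdorff_cvg (E `&` `]a, +oo[).
have c2 := @hausdorff_cvg (E `&` ~` `]a, +oo[).
rewrite -!hausdorffE in c1 c2.
have c12 : (hausdorff_pre h delta (E `&` `]a, +oo[) +
   hausdorff_pre h delta (E `&` ~` `]a, +oo[))%E @[delta --> 0^'+] -->
   (hausdorff h (E `&` `]a, +oo[) + hausdorff h (E `&` ~` `]a, +oo[))%E.
  by apply: cvgeD => //; apply: ge0_adde_def; rewrite inE hausdorff_ge0.
rewrite -(cvg_lim _ c12)//; apply: lime_le; first by apply/cvg_ex; eexists; exact: c12.
near=> delta.
have d0 : 0 < delta by near: delta; exact: nbhs_right_gt.
have d1 : delta <= 1 by near: delta; exact: nbhs_right_le.
have c3 : (hausdorff h E + (h eta + h eta)%:E)%E @[eta --> 0^'+] --> (hausdorff h E + (0+0)%:E)%E.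
  apply: cvgeD; [by rewrite addr0 fin_num_adde_defl | exact: cvg_cst|].
  by apply: cvg_EFin; [exact: nearW|apply: cvgD].
rewrite addr0 adde0 in c3.
rewrite -(cvg_lim _ c3)//; apply: lime_ge; first by apply/cvg_ex; eexists; exact: c3.
near=> eta.
have e0 : 0 < eta by near: eta; exact: nbhs_right_gt.
have ed : eta < delta by near: eta; exact: nbhs_right_lt.
apply: le_trans (hausdorff_pre_cut a E e0 ed d1) _.
by rewrite leeD2r// hausdorff_ge_pre.
Unshelve. all: by end_near. Qed.

Lemma borel_caratheodory (A : set (measurableTypeR R)) : measurable A ->
  (hausdorff h).-caratheodory A.
Proof.
move=> mA; have {mA} : (@ocitv R).-sigma.-measurable A := mA.
rewrite RGenOInfty.measurableE.
have cs : sigma_algebra setT ((hausdorff h).-caratheodory : set (set R)).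
  split; first exact: caratheodory_measurable_set0.
    by move=> B mB; rewrite setTD; exact: caratheodory_measurable_setC.
  exact: caratheodory_measurable_bigcup.
by apply: (@smallest_sub _ _ _ _ cs) => _ [x ->]; exact: hausdorff_ray_caratheodory.
Qed.

Lemma hausdorffU A B : (hausdorff h (A `|` B) <= hausdorff h A + hausdorff h B)%E.
Proof. exact: outer_measureU2. Qed.

Lemma hausdorff_countable A : A `<=` `[0, 1] -> countable A -> hausdorff h A = 0%E.
Proof.
move=> A01 /countable_injP[f injf]; apply/eqP; rewrite eq_le hausdorff_ge0 andbT.
rewrite (_ : A = \bigcup_n [set x | A x /\ f x = n]); last first.
  by apply/seteqP; split=> [x Ax|x [n _ []]//]; exists (f x).
apply: le_trans (hausdorff_sigma_subadditive _) _.
rewrite eseries0// => n _ _.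
have [[x [Ax fx]]|F0] := pselect ([set x | A x /\ f x = n] !=set0).
  rewrite (_ : [set x | A x /\ f x = n] = [set x]).
    by apply: hausdorff1; have := A01 _ Ax; rewrite /= in_itv.
  apply/seteqP; split=> [y [Ay fy]|y ->//]; apply: injf.
  - exact: mem_set.
  - exact: mem_set.
  - by rewrite fx.
rewrite (_ : [set x | A x /\ f x = n] = set0) ?hausdorff_set0//.
by apply/seteqP; split=> // x Hx; case: F0; exists x.
Qed.

Lemma hausdorff_semi_sigma_additive :
  semi_sigma_additive (hausdorff h : set (measurableTypeR R) -> \bar R).
Proof.
move=> F mF tF mUF.
apply: (@caratheodory_measure_sigma_additive R R (hausdorff h)) => //.
  by move=> i; exact: borel_caratheodory.
exact: borel_caratheodory.
Qed.

Lemma hausdorff_measure_ex :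
  exists M : {measure set (measurableTypeR R) -> \bar R},
    (M : set (measurableTypeR R) -> \bar R) = hausdorff h.
Proof.
pose M := isMeasure.Build _ _ _ (hausdorff h : set (measurableTypeR R) -> \bar R)
  hausdorff_set0 hausdorff_ge0 hausdorff_semi_sigma_additive.
pose MM : {measure set (measurableTypeR R) -> \bar R} := HB.pack (hausdorff h : set (measurableTypeR R) -> \bar R) M.
by exists MM.
Qed.

End HausdorffMeasure.

(** * Cantor sets with blocks of digits *)
Section CantorSet.
Variables (R : realType) (lv : nat -> nat).
Hypothesis lv0 : lv 0 = 0%N.
Hypothesis lvS : forall k, (lv k + 2 <= lv k.+1)%N.
Implicit Types (x y a b t : R) (k m : nat).

(** The length of the basic intervals after [k] blocks, when [lv k] is the
number of binary digits in the first [k] blocks. *)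
Definition mesh k : R := 2^-1 ^+ lv k.
(** The distance between the left ends of the two halves of a basic interval;
it is the value of the [k]-th block of digits when they are all 1. *)
Definition gap k : R := mesh k - mesh k.+1.
Local Notation r := mesh.
Local Notation c := gap.

(** The union of the basic intervals of level [k + m] inside [[0, mesh k]]. *)
Fixpoint stage m k : set R :=
  if m is m'.+1 then stage m' k.+1 `|` [set x | stage m' k.+1 (x - c k)]
  else `[0, r k].

Definition cantor k : set R := \bigcap_m stage m k.

(** The left ends of the basic intervals of [stage m k]. *)
Fixpoint corners m k : seq R :=
  if m is m'.+1 then corners m' k.+1 ++ [seq x + c k | x <- corners m' k.+1]
  else [:: 0].

Lemma mesh_gt0 k : 0 < r k.
Proof. by rewrite exprn_gt0// invr_gt0. Qed.

Lemma mesh0 : r 0 = 1.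
Proof. by rewrite /mesh lv0 expr0. Qed.

Lemma meshS k : 4 * r k.+1 <= r k.
Proof.
rewrite /mesh -(subnK (lvS k)) addnCA exprD exprD.
have -> : 4 * (2^-1 ^+ lv k * (2^-1 ^+ (lv k.+1 - (lv k + 2)) * 2^-1 ^+ 2)) =
  2^-1 ^+ lv k * 2^-1 ^+ (lv k.+1 - (lv k + 2)) :> R.
  by rewrite -[(2^-1 : R) ^+ 2]/(2^-1 * 2^-1); field.
apply: ler_piMr; first by rewrite exprn_ge0// invr_ge0.
by rewrite exprn_ile1// ?invr_ge0// invf_le1// ler1n.
Qed.

Lemma meshS_le k : r k.+1 <= r k.
Proof. by have := meshS k; have := mesh_gt0 k.+1; lra. Qed.

Lemma mesh_le j k : (j <= k)%N -> r k <= r j.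
Proof.
by apply: (homo_leq (r := fun x y => y <= x)) => // [x y z /[swap]|i];
  [exact: le_trans|exact: meshS_le].
Qed.

Lemma mesh_le1 k : r k <= 1.
Proof. by rewrite -mesh0; exact: mesh_le. Qed.

Lemma meshS_le4 k : r k.+1 <= 4^-1.
Proof. by have := mesh_le1 k; have := meshS k; lra. Qed.

Lemma mesh_cvg0 : r @ \oo --> 0.
Proof.
apply: (@squeeze_cvgr _ _ _ _ (fun=> 0) (fun k => 2^-1 ^+ k)).
- near=> k; rewrite ltW ?mesh_gt0//=.
  rewrite /mesh ler_wiXn2l ?invr_ge0 ?invf_le1 ?ler1n//.
  by elim: (k) => // j /leq_ltn_trans; apply; apply: leq_trans (lvS j); rewrite addn2.
- exact: cvg_cst.
- by apply: cvg_expr; rewrite ger0_norm ?invr_ge0// invf_lt1// ltr1n.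
Unshelve. all: by end_near. Qed.

Lemma gap_ge k : 3 * r k.+1 <= c k.
Proof. by have := meshS k; rewrite /gap; lra. Qed.

Lemma stage_sub m k x : stage m k x -> 0 <= x <= r k.
Proof.
elim: m k x => [|m IH] k x /=; first by rewrite in_itv.
have := meshS_le k; have := gap_ge k; have := mesh_gt0 k.+1; rewrite /gap.
by move=> ? ? ? [/IH/andP[? ?]|/IH/andP[? ?]]; lra.
Qed.

Lemma cantor_sub k x : cantor k x -> 0 <= x <= r k.
Proof. by move=> /(_ 0%N I) /stage_sub. Qed.

Lemma cantor_sub01 k : cantor k `<=` `[0, 1].
Proof.
by move=> x /cantor_sub; rewrite /= in_itv/=; have := mesh_le1 k; lra.
Qed.

(** The two halves are disjoint because [gap k >= 3 * mesh k.+1]; so the same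
half works for all stages. *)
Lemma cantorE k x : cantor k x <-> cantor k.+1 x \/ cantor k.+1 (x - c k).
Proof.
have r0 := mesh_gt0 k.+1; have cr := gap_ge k.
split=> [Cx|[Cx|Cx] [|m] _]; last 4 first.
- have := cantor_sub Cx; have := meshS_le k; rewrite /= in_itv/=; lra.
- by left; apply: Cx.
- by have := cantor_sub Cx; rewrite /= in_itv/=; rewrite /gap in cr *; lra.
- by right; apply: Cx.
have [xr|xr] := leP x (r k.+1); [left|right] => m _.
  by case: (Cx m.+1 I) => // /stage_sub; lra.
by case: (Cx m.+1 I) => // /stage_sub; lra.
Qed.

Lemma stage_sym m k x : stage m k x -> stage m k (r k - x).
Proof.
elim: m k x => [|m IH] k x /=; first by rewrite !in_itv/=; lra.
move=> [/IH|/IH] H; [right|left].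
  by rewrite [X in stage _ _ X](_ : _ = r k.+1 - x)//= /gap; ring.
by move: H; rewrite [X in stage _ _ X](_ : _ = r k - x)// /gap; ring.
Qed.

Lemma cantor_sym k x : cantor k x -> cantor k (r k - x).
Proof. by move=> Cx m _; apply: stage_sym; exact: Cx. Qed.

Lemma stage_closed m k : closed (stage m k).
Proof.
elim: m k => [|m IH] k /=; first exact: interval_closed.
apply: closedU => //; apply: (closed_comp _ (IH k.+1)) => x _.
by apply: cvgB; [exact: cvg_id|exact: cvg_cst].
Qed.

Lemma cantor_closed k : closed (cantor k).
Proof. by apply: closed_bigI => m _; exact: stage_closed. Qed.

Lemma cantor_compact k : compact (cantor k).
Proof.
apply: (subclosed_compact _ (@segment_compact _ 0 1)); first exact: cantor_closed.
exact: cantor_sub01.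
Qed.

Lemma cantor_measurable k : measurable (cantor k : set (measurableTypeR R)).
Proof. by apply: closed_measurable; exact: cantor_closed. Qed.

Lemma corners_bounds m k x : x \in corners m k -> 0 <= x <= r k - r (k + m).
Proof.
elim: m k x => [|m IH] k x /=.
  by rewrite inE addn0 subrr => /eqP ->; rewrite lexx.
rewrite mem_cat addnS -addSn => /orP[/IH|/mapP[y /IH + ->]].
  have := meshS_le k; lra.
by have := gap_ge k; have := mesh_gt0 k.+1; rewrite /gap; lra.
Qed.

Lemma cantor0 k : cantor k 0.
Proof.
move=> m _; elim: m k => [|m IH] k /=; last by left.
by rewrite in_itv/= lexx ltW// mesh_gt0.
Qed.

Lemma corners_cantor m k x : x \in corners m k -> cantor k x.
Proof.
elim: m k x => [|m IH] k x /=.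
  by rewrite inE => /eqP ->; exact: cantor0.
rewrite mem_cat cantorE => /orP[/IH|/mapP[y /IH + ->]]; first by left.
by rewrite addrK; right.
Qed.

Lemma size_corners m k : size (corners m k) = (2 ^ m)%N.
Proof.
by elim: m k => [|m IH] k //=; rewrite size_cat size_map !IH expnS mul2n addnn.
Qed.

End CantorSet.

(** * The Hausdorff measure of the Cantor set *)
Lemma size_le_sum_count (T : eqType) (s : seq T) (P : nat -> pred T) N :
  (forall x, x \in s -> exists2 i, (i < N)%N & P i x) ->
  (size s <= \sum_(i < N) count (P i) s)%N.
Proof.
elim: s => [|x s IH] Hs; first by [].
have [i iN Pi] := Hs x (mem_head _ _).
rewrite /= big_split /= -addn1 addnC leq_add//.
  by rewrite (bigD1 (Ordinal iN))//= Pi.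
by apply: IH => y ys; apply: Hs; rewrite inE ys orbT.
Qed.

(** The gauges for which the basic interval covers of the Cantor set are
optimal. In [cg_split], [a] and [b] are the lengths of the parts of an interval
in the two halves of a basic interval of level [k], and the argument of [h] on
the right is the length of this interval. The inequality is only required for
short intervals, as it may fail at the first levels. *)
Record cantor_gauge (R : realType) (lv : nat -> nat) (h : R -> R) : Prop := {
  cg_lv0 : lv 0 = 0%N;
  cg_lvS : forall k, (lv k + 2 <= lv k.+1)%N;
  cg_h0 : h 0 = 0;
  cg_mono : forall x y, 0 <= x -> x <= y -> y < 1 -> h x <= h y;
  cg_rc : forall x, 0 <= x < 1 -> h y @[y --> x^'+] --> h x;
  cg_mesh : forall k, h (mesh R lv k.+1) = 2^-1 ^+ k.+1;
  cg_split : exists2 eta : R, 0 < eta <= 4^-1 &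
    forall k a b, mesh R lv k < 2 * eta ->
      0 <= a <= mesh R lv k.+1 -> 0 <= b <= mesh R lv k.+1 ->
      h a + h b <= h (mesh R lv k - 2 * mesh R lv k.+1 + a + b) }.

Section CantorMeasure.
Variables (R : realType) (lv : nat -> nat) (h : R -> R).
Hypothesis hG : cantor_gauge lv h.
Implicit Types (x y a b t : R) (k m : nat).
Local Notation r := (mesh R lv).
Local Notation c := (gap R lv).
Local Notation cantor := (@cantor R lv).
Local Notation stage := (@stage R lv).
Local Notation corners := (@corners R lv).
Let lv0 := cg_lv0 hG.
Let lvS := cg_lvS hG.
Let h0 := cg_h0 hG.
Let h_mono := cg_mono hG.
Let r_gt0 k : 0 < r k := mesh_gt0 R lv k.

Lemma cg_ge0 x : 0 <= x -> x < 1 -> 0 <= h x.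
Proof. by move=> x0 x1; rewrite -h0; exact: h_mono. Qed.

Lemma cg_cvg0 : h x @[x --> 0^'+] --> 0.
Proof. by rewrite -[X in _ --> X]h0; apply: (cg_rc hG); rewrite lexx ltr01. Qed.

Let h_cvg0 := cg_cvg0.

Lemma stage_sub01 m k : stage m k `<=` `[0, 1].
Proof.
by move=> x /(stage_sub lvS); rewrite /= in_itv/=; have := @mesh_le1 R lv lv0 lvS k; lra.
Qed.

(** The [2 ^ m] basic intervals as a cover. *)
Lemma hausdorff_pre_stage delta m k : 0 < delta <= 1 -> r (k + m) < delta ->
  (hausdorff_pre h delta (stage m k) <= (2 ^+ m * h (r (k + m)))%:E)%E.
Proof.
move=> d; elim: m k => [|m IH] k rd.
  rewrite expr0 mul1r addn0 in rd *; apply: hausdorff_pre_single => //.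
  - exact: stage_sub01.
  - by rewrite rd ltW.
  - by move=> x y; rewrite /= !in_itv/= ler_norml; lra.
rewrite addnS -addSn in rd *.
apply: le_trans (hausdorff_preU _ _ _ _ d) _ => //.
have tr : (hausdorff_pre h delta [set x | stage m k.+1 (x - c k)%R] <=
    hausdorff_pre h delta (stage m k.+1))%E.
  apply: (@hausdorff_pre_lipschitz _ _ h0 h_mono _ (fun x : R => x + c k)) => //.
  - by move=> x /= ?; apply: (@stage_sub01 m.+1 k); right.
  - by move=> x /= Hx; exists (x - c k) => //; rewrite subrK.
  - by move=> x y; rewrite (_ : x + c k - (y + c k) = x - y)//; ring.
apply: le_trans (leeD (IH _ rd) (le_trans tr (IH _ rd))) _.
by rewrite -EFinD lee_fin exprS; lra.
Qed.

Lemma hausdorff_cantor_le k : (hausdorff h (cantor k) <= (2^-1 ^+ k)%:E)%E.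
Proof.
apply: (@hausdorff_le _ _ 1) => // delta /andP[d0 _] d1.
have [m rm] : exists m, r (k + m.+1) < delta.
  have /cvgrPdist_lt/(_ _ d0)[m _ Hm] := @mesh_cvg0 R lv lvS.
  exists m; have := Hm (k + m.+1)%N; rewrite /= sub0r normrN gtr0_norm//.
  by apply; rewrite addnS ltnW// ltnS leq_addl.
apply: (@le_trans _ _ (hausdorff_pre h delta (stage m.+1 k))).
  by apply: le_hausdorff_pre => x; exact.
apply: le_trans (hausdorff_pre_stage _ rm) _; first by rewrite d0 ltW.
rewrite addnS (cg_mesh hG) -addnS exprD lee_fin mulrCA -exprMn divff//.
by rewrite expr1n mulr1.
Qed.

(** The uniform probability on the left ends of all basic intervals of level
[k + m], an approximation of the Cantor measure, is restricted here to
[[0, mesh k]] and bounded on intervals by the gauge, up to the error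
[mesh (k + m)] in the length. An
interval that meets both halves is cut into its intersections with them, whose
gauges [cg_split] compares with the gauge of the whole. *)
Lemma corners_count eta : 0 < eta <= 4^-1 ->
    (forall k a b, r k < 2 * eta ->
      0 <= a <= r k.+1 -> 0 <= b <= r k.+1 ->
      h a + h b <= h (r k - 2 * r k.+1 + a + b)) ->
  forall m k a b, (0 < k + m)%N -> a <= b -> b - a < eta ->
  2^-1 ^+ (k + m) * (count (fun x => a <= x <= b) (corners m k))%:R <=
    h (b - a + r (k + m)).
Proof.
move=> /andP[eta0 eta4] split; elim=> [|m IH] k a b km ab abe.
  rewrite addn0 in km *; case: k km => // k _; rewrite -(cg_mesh hG).
  apply: (@le_trans _ _ (h (r k.+1))).
    apply: ler_piMr; last by rewrite /= addn0 lern1 leq_b1.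
    by rewrite cg_ge0 ?ltW//; have := @meshS_le4 R lv lv0 lvS k; lra.
  by apply: h_mono; [exact: ltW|lra|have := @meshS_le4 R lv lv0 lvS k; lra].
rewrite addnS -addSn; set K := (k.+1 + m)%N.
rewrite /= count_cat count_map.
rewrite (@eq_count _ (preim _ _) (fun x => a - c k <= x <= b - c k)); last first.
  by move=> x /=; rewrite lerBlDr lerBrDr.
set N1 := count _ _; set N2 := count _ _.
have rK4 : r K <= 4^-1 by rewrite /K addSn; exact: meshS_le4.
have rK0 : 0 < r K by [].
have [N10|] := posnP N1.
  rewrite N10 add0n (_ : b - a = (b - c k) - (a - c k)); last by ring.
  by apply: IH; rewrite ?addSn//; lra.
have [N20|] := posnP N2.
  by move=> _; rewrite N20 addn0; apply: IH; rewrite ?addSn.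
rewrite -!has_count => /hasP[y yL /andP[ay yb]] /hasP[x xL /andP[ax xb]].
have /andP[x0 x1] := corners_bounds lvS xL.
have /andP[y0 y1] := corners_bounds lvS yL.
rewrite -/K in x1 y1.
have gk := @gap_ge R lv lvS k; have gE : c k = r k - r k.+1 by [].
have rk0 : 0 < r k.+1 by [].
(* The parts of [[a, b]] are [[a1, b1]] in the left half and, translated by
   [- c k], [[0, b2]] in the right half. *)
pose a1 := Num.max a 0; pose b1 := r k.+1 - r K.
pose b2 := Num.min (b - c k) b1.
have a1x : a1 <= x by rewrite ge_max ax.
have yb2 : y <= b2 by rewrite le_min yb.
have aa1 : a <= a1 by rewrite le_max lexx.
have a10 : 0 <= a1 by rewrite le_max lexx orbT.
have b2b : b2 <= b - c k by rewrite ge_min lexx.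
have b2b1 : b2 <= b1 by rewrite ge_min lexx orbT.
have C1 : (N1 <= count (fun z => (a1 <= z <= b1)%R) (corners m k.+1))%N.
  rewrite /N1 -(size_filter (fun x => a <= x <= b)) -size_filter.
  rewrite (@eq_in_filter _ _ (fun z => (a1 <= z <= b1) && (a <= z <= b))).
    by rewrite !size_filter; apply: sub_count => z /andP[].
  move=> z zL; have /andP[z0 z1] := corners_bounds lvS zL.
  by rewrite /= ge_max z0 andbT /b1 /K z1 andbT; case: (a <= z).
have C2 : (N2 <= count (fun z => (0 <= z <= b2)%R) (corners m k.+1))%N.
  rewrite /N2 -(size_filter (fun x => a - c k <= x <= b - c k)) -size_filter.
  rewrite (@eq_in_filter _ _ (fun z => (0 <= z <= b2) && (a - c k <= z <= b - c k))).
    by rewrite !size_filter; apply: sub_count => z /andP[].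
  move=> z zL; have /andP[z0 z1] := corners_bounds lvS zL.
  by rewrite /= le_min z0 /b1 /K z1 andbT /=; case: (a - c k <= z); case: (z <= b - c k).
have I1 : 2^-1 ^+ K * N1%:R <= h (r k.+1 - a1).
  rewrite (_ : r k.+1 - a1 = b1 - a1 + r K); last by rewrite /b1; ring.
  apply: le_trans (IH k.+1 a1 b1 _ _ _); rewrite ?addSn//; last 2 first.
  - by rewrite /b1; lra.
  - by rewrite /b1; lra.
  by rewrite ler_wpM2l ?ler_nat// exprn_ge0// invr_ge0.
have I2 : 2^-1 ^+ K * N2%:R <= h (b2 + r K).
  rewrite -[b2]subr0.
  apply: le_trans (IH k.+1 0 b2 _ _ _); rewrite ?addSn//; last 2 first.
  - by lra.
  - by move: b2b1; rewrite /b1; lra.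
  by rewrite ler_wpM2l ?ler_nat// exprn_ge0// invr_ge0.
rewrite natrD mulrDr; apply: le_trans (lerD I1 I2) _.
apply: le_trans (split k _ _ _ _ _) _.
- lra.
- by rewrite /b1 in b2b1; lra.
- by rewrite /b1 in b2b1; lra.
apply: h_mono; rewrite /b1 in b2b1; lra.
Qed.

(** Enlarge the sets of a countable cover to open intervals, at a total cost
[e] by right continuity of the gauge, and extract a finite subcover. For a
sufficiently deep level the error term of [corners_count] is smaller than the
enlargement, and all left ends of basic intervals lie in the cover. *)
Lemma hausdorff_cantor_ge : (1 <= hausdorff h (cantor 0))%E.
Proof.
have [eta eta4 split] := cg_split hG; case/andP: (eta4) => eta0 eta1.
apply: (le_trans _ (hausdorff_ge_pre _ _ eta0)).
apply: le_ereal_inf_tmp => _ [I [I1 I2] <-]; apply/lee_addgt0Pr => e e0.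
apply: le_trans (epsilon_trick _ _ _) => //; last 2 first.
- move=> i; rewrite lee_fin cg_ge0 ?diam_ge0// (lt_trans (I1 i).2)//; lra.
- exact: ltW.
have rhoP i : exists rho : R, [/\ 0 < rho, diam (I i) + rho < eta &
    h (diam (I i) + rho) <= h (diam (I i)) + e / (2 ^ i.+1)%:R].
  have dI1 : 0 <= diam (I i) < 1.
    by rewrite diam_ge0 (lt_trans (I1 i).2)//; lra.
  have ei : 0 < e / (2 ^ i.+1)%:R by rewrite divr_gt0// ltr0n expn_gt0.
  have /cvgrPdist_le/(_ _ ei) Hi := cg_rc hG dI1.
  near (diam (I i))^'+ => z; exists (z - diam (I i)).
  rewrite subr_gt0 addrC subrK; split.
  - by near: z; exact: nbhs_right_gt.
  - by near: z; apply: nbhs_right_lt; exact: (I1 i).2.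
  - have : `|h (diam (I i)) - h z| <= e / (2 ^ i.+1)%:R by near: z.
    by rewrite ler_norml => /andP[]; lra.
have [rho Hrho] := choice rhoP.
pose U i : set R := [set` `](inf (I i) - rho i / 4), (sup (I i) + rho i / 4)[].
have Ibnd i : has_lbound (I i) /\ has_ubound (I i).
  by split; [exists 0|exists 1] => z /(I1 i).1; rewrite /= in_itv/= => /andP[].
have Ulen i : sup (I i) + rho i / 4 - (inf (I i) - rho i / 4) <= diam (I i) + rho i / 2.
  suff : sup (I i) - inf (I i) <= diam (I i) by lra.
  have [[z Iz]|I0] := pselect (I i !=set0); last first.
    have -> : I i = set0 by apply/seteqP; split=> // z Iz; case: I0; exists z.
    by rewrite sup0 inf0 subrr diam_ge0.
  rewrite lerBlDr -lerBlDl; apply: lb_le_inf; first by exists z.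
  move=> y Iy; rewrite lerBlDl; apply: ge_sup; first by exists z.
  move=> x Ix; rewrite -lerBlDr; apply: le_trans (ler_norm _) _.
  by apply: diam_ub => //; exact: (I1 i).1.
have := @cantor_compact R lv lv0 lvS 0; rewrite compact_cover.
move=> /(_ nat setT U) [|z Cz|D _ CD].
- by move=> i _; exact: interval_open.
- have [i _ Iz] := I2 _ Cz; exists i => //; rewrite /U /= in_itv/=.
  have [rho0 _ _] := Hrho i.
  have : inf (I i) <= z by apply: ge_inf => //; exact: (Ibnd i).1.
  have : z <= sup (I i) by apply: ub_le_sup => //; exact: (Ibnd i).2.
  by lra.
have [N DN] : exists N, forall i, i \in D -> (i < N)%N.
  exists (\max_(i <- enum_fset D) i).+1 => i iD; rewrite ltnS.
  exact: (@leq_bigmax_seq _ _ xpredT id).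
have [K HK] : exists K, forall i, (i < N)%N -> r (0 + K.+1) <= rho i / 2.
  elim: (N) => [|n [K HK]]; first by exists 0%N.
  have [rho0 _ _] := Hrho n.
  have rho2 : 0 < rho n / 2 by rewrite divr_gt0.
  have /cvgrPdist_lt/(_ _ rho2)[m _ Hm] := @mesh_cvg0 R lv lvS.
  exists (maxn K m) => i; rewrite ltnS leq_eqVlt => /orP[/eqP ->|/HK ir].
    have := Hm (maxn K m).+1; rewrite /= sub0r normrN gtr0_norm// => /(_ _)/ltW; apply.
    by rewrite leqW// leq_maxr.
  by apply: le_trans ir; apply: mesh_le => //; rewrite !add0n ltnS leq_maxl.
apply: (@le_trans _ _ (\sum_(i < N) (h (diam (I i)) + e / (2 ^ i.+1)%:R)%:E)%E); last first.
  rewrite -(big_mkord xpredT (fun i => (h (diam (I i)) + e / (2 ^ i.+1)%:R)%:E)).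
  rewrite (eq_bigr (fun i => ((h (diam (I i)))%:E + (e / (2 ^ i.+1)%:R)%:E)%E))//.
  apply: nneseries_lim_ge => i _ _; rewrite -EFinD lee_fin addr_ge0//.
    by rewrite cg_ge0 ?diam_ge0// (lt_trans (I1 i).2)//; lra.
  by rewrite divr_ge0// ltW.
rewrite sumEFin lee_fin.
pose P i x := inf (I i) - rho i / 4 <= x <= sup (I i) + rho i / 4.
have sz : (2 ^ K.+1 <= \sum_(i < N) count (P i) (corners K.+1 0))%N.
  rewrite -(size_corners R lv K.+1 0); apply: size_le_sum_count => x xC.
  have [i iD] := CD _ (corners_cantor lvS xC); rewrite /U /= in_itv/= => /andP[/ltW ? /ltW ?].
  by exists i; [exact: DN|rewrite /P; apply/andP].
have {sz} : 1 <= \sum_(i < N) 2^-1 ^+ K.+1 * (count (P i) (corners K.+1 0))%:R :> R.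
  rewrite -mulr_sumr -natr_sum; have E1 : 2^-1 ^+ K.+1 * (2 ^ K.+1)%:R = 1 :> R.
    by rewrite natrX -exprMn mulVf// expr1n.
  by rewrite -[leLHS]E1 ler_wpM2l ?exprn_ge0 ?invr_ge0// ler_nat.
move=> /le_trans; apply; apply: ler_sum => i _.
have [rho0 di hi] := Hrho i; apply: le_trans hi.
have dI0 := diam_ge0 (I i).
have ab : inf (I i) - rho i / 4 <= sup (I i) + rho i / 4.
  suff : inf (I i) <= sup (I i) by lra.
  have [[z Iz]|I0] := pselect (I i !=set0); last first.
    have -> : I i = set0 by apply/seteqP; split=> // z Iz; case: I0; exists z.
    by rewrite sup0 inf0.
  apply: (@le_trans _ _ z); first by apply: ge_inf => //; exact: (Ibnd i).1.
  by apply: ub_le_sup => //; exact: (Ibnd i).2.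
have := Ulen i => Ui.
have bae : sup (I i) + rho i / 4 - (inf (I i) - rho i / 4) < eta by lra.
apply: le_trans (@corners_count _ eta4 split K.+1 0%N _ _ isT ab bae) _.
have := HK i (ltn_ord i); have := r_gt0 (0 + K.+1) => *; apply: h_mono; lra.
Unshelve. all: by end_near. Qed.

Lemma hausdorff_cantor0 : hausdorff h (cantor 0) = 1%E.
Proof.
apply/eqP; rewrite eq_le hausdorff_cantor_ge andbT.
by have := hausdorff_cantor_le 0; rewrite expr0.
Qed.

End CantorMeasure.

(** * Intersections of the Cantor set with its translates *)
Section CantorIntersection.
Variables (R : realType) (lv : nat -> nat) (h : R -> R).
Hypothesis hG : cantor_gauge lv h.
Implicit Types (x y a b t : R) (k m : nat).
Local Notation r := (mesh R lv).
Local Notation c := (gap R lv).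
Local Notation cantor := (@cantor R lv).
Let lv0 := cg_lv0 hG.
Let lvS := cg_lvS hG.
Let h0 := cg_h0 hG.
Let h_mono := cg_mono hG.
Let r_gt0 k : 0 < r k := mesh_gt0 R lv k.

(** The lengths [gap k] are rational, so an irrational difference stays
irrational, and in particular nonzero, when signed digits are removed from it. *)
Definition rationals : set R := [set ratr q | q in [set: rat]].

Lemma rationals0 : rationals 0.
Proof. by exists 0 => //; rewrite rmorph0. Qed.

Lemma rationalsD x y : rationals x -> rationals y -> rationals (x + y).
Proof. by move=> [p _ <-] [q _ <-]; exists (p + q) => //; rewrite rmorphD. Qed.

Lemma rationalsN x : rationals x -> rationals (- x).
Proof. by move=> [p _ <-]; exists (- p) => //; rewrite rmorphN. Qed.

Lemma rationals1 : rationals 1.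
Proof. by exists 1 => //; rewrite rmorph1. Qed.

Lemma rationals_gap k : rationals (c k).
Proof.
exists (2^-1 ^+ lv k - 2^-1 ^+ lv k.+1) => //.
have E : ratr (2^-1) = 2^-1 :> R by rewrite fmorphV rmorph_nat.
by rewrite rmorphB !rmorphXn /= E.
Qed.

Local Notation selfcap k t := (cantor k `&` [set x | cantor k (x - t)]).

Let hausdorff_shift A t : [set x | A (x - t)] `<=` `[0, 1] ->
  (hausdorff h [set x | A (x - t)%R] <= hausdorff h A)%E.
Proof.
move=> A01; apply: (@hausdorff_lipschitz _ _ h0 h_mono (fun x => x + t)) => //.
  by move=> x /= Ax; exists (x - t) => //; rewrite subrK.
by move=> x y; rewrite (_ : x + t - (y + t) = x - y)//; ring.
Qed.

(** Induction on [j], the number of nonzero signed digits of [t] that have been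
used. If [|t| <= mesh k.+1], the two points of the Cantor set have the same
[k]-th digit, and the intersection consists of two copies of the one in level
[k.+1]. Otherwise the sign of [t] determines both digits, there is only one
copy, and the bound is halved. Since [t] is not 0, this happens at some level. *)
Lemma hausdorff_selfcap_le j k t : ~ rationals t ->
  (hausdorff h (selfcap k t) <= (2^-1 ^+ (k + j))%:E)%E.
Proof.
elim: j k t => [|j IHj] k t tQ.
  rewrite addn0; apply: le_trans (hausdorff_cantor_le hG k).
  by apply: le_hausdorff => //; exact: subIsetl.
have [m tm] : exists m, r (k + m).+1 < `|t|.
  have t0 : 0 < `|t|.
    by rewrite normr_gt0; apply: contra_not_neq tQ => ->; exact: rationals0.
  have /cvgrPdist_lt/(_ _ t0)[m _ Hm] := @mesh_cvg0 R lv lvS.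
  exists m; have := Hm (k + m).+1; rewrite /= sub0r normrN gtr0_norm//.
  by apply; rewrite leqW// leq_addl.
have big i u : ~ rationals u -> r i.+1 < `|u| ->
    (hausdorff h (selfcap i u) <= (2^-1 ^+ (i + j.+1))%:E)%E.
  move=> uQ iu; rewrite addnS -addSn.
  have ci := @gap_ge R lv lvS i; have ri := r_gt0 i.+1.
  have {iu} nu : ~ (- r i.+1 <= u <= r i.+1).
    by apply/negP; rewrite -ler_norml -ltNge.
  have [u0|u0] := ltP 0 u.
    apply: le_trans (IHj i.+1 (u - c i) _); last first.
      by move=> H; apply: uQ; rewrite -(subrK (c i) u); exact: rationalsD (rationals_gap i).
    apply: le_trans (hausdorff_shift (t := c i) _); last first.
      by move=> x [Hx _]; apply: (@cantor_sub01 R lv lv0 lvS i); apply/(cantorE lvS); right.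
    apply: le_hausdorff => // x [/(cantorE lvS)[H1|H1] /(cantorE lvS)[H2|H2]].
    - have := cantor_sub lvS H1; have := cantor_sub lvS H2.
      by move=> *; exfalso; apply: nu; lra.
    - have := cantor_sub lvS H1; have := cantor_sub lvS H2.
      by move=> *; exfalso; lra.
    - by split=> //=; rewrite (_ : x - c i - (u - c i) = x - u)//; ring.
    - have := cantor_sub lvS H1; have := cantor_sub lvS H2.
      by move=> *; exfalso; apply: nu; lra.
  apply: le_trans (IHj i.+1 (u + c i) _); last first.
    move=> H; apply: uQ; rewrite -(addrK (c i) u); apply: rationalsD => //.
    exact: rationalsN (rationals_gap i).
  apply: le_hausdorff => // x [/(cantorE lvS)[H1|H1] /(cantorE lvS)[H2|H2]].
  - have := cantor_sub lvS H1; have := cantor_sub lvS H2.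
    by move=> *; exfalso; apply: nu; lra.
  - by split=> //=; rewrite opprD addrA.
  - have := cantor_sub lvS H1; have := cantor_sub lvS H2.
    by move=> *; exfalso; apply: nu; lra.
  - have := cantor_sub lvS H1; have := cantor_sub lvS H2.
    by move=> *; exfalso; apply: nu; lra.
elim: m k t tQ tm => [|m IHm] k t tQ tm; first by apply: big; rewrite // addn0 in tm.
have [kt|kt] := ltP (r k.+1) `|t|; first exact: big.
have ck := @gap_ge R lv lvS k; have rk := r_gt0 k.+1.
rewrite addnS -addSn in tm.
have IH := IHm _ _ tQ tm.
apply: (@le_trans _ _ (hausdorff h (selfcap k.+1 t `|`
    [set x | selfcap k.+1 t (x - c k)%R]))).
  move: kt; rewrite ler_norml => kt.
  apply: le_hausdorff => // x [/(cantorE lvS)[H1|H1] /(cantorE lvS)[H2|H2]].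
  - by left.
  - have := cantor_sub lvS H1; have := cantor_sub lvS H2.
    by move=> *; exfalso; lra.
  - have := cantor_sub lvS H1; have := cantor_sub lvS H2.
    by move=> *; exfalso; lra.
  - by right; split=> //=; rewrite addrAC.
apply: le_trans (hausdorffU h0 h_mono _ _) _.
apply: (@le_trans _ _ (2^-1 ^+ (k.+1 + j.+1) + 2^-1 ^+ (k.+1 + j.+1))%:E).
  rewrite EFinD; apply: leeD => //; apply: le_trans IH; apply: hausdorff_shift.
  by move=> x [Hx _]; apply: (@cantor_sub01 R lv lv0 lvS k); apply/(cantorE lvS); right.
by rewrite addSn exprS lee_fin; lra.
Qed.

Lemma hausdorff_selfcap t : ~ rationals t -> hausdorff h (selfcap 0 t) = 0%E.
Proof.
move=> tQ; apply/eqP; rewrite eq_le hausdorff_ge0// andbT.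
have c0 : (2^-1 ^+ n)%:E @[n --> \oo] --> (0 : \bar R)%E.
  apply: cvg_EFin; first exact: nearW.
  by apply: cvg_expr; rewrite ger0_norm ?invr_ge0// invf_lt1// ltr1n.
rewrite -(cvg_lim _ c0)//; apply: lime_ge; first by apply/cvg_ex; eexists; exact: c0.
by near=> n; exact: (@hausdorff_selfcap_le n 0).
Unshelve. all: by end_near. Qed.

End CantorIntersection.

(** * Binary expansions with constant blocks *)
Section BinaryCantor.
Variables (R : realType) (lv : nat -> nat).
Hypothesis lv0 : lv 0 = 0%N.
Hypothesis lvS : forall k, (lv k + 2 <= lv k.+1)%N.
Implicit Types (x : R) (a : nat -> bool).
Local Notation r := (mesh R lv).
Local Notation c := (gap R lv).
Local Notation cantor := (@cantor R lv).

Let psum a n : R := \sum_(1 <= j < n.+1) (a j)%:R / 2 ^+ j.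

Lemma geometric_half m n : (m <= n)%N ->
  \sum_(m.+1 <= j < n.+1) (2 ^+ j)^-1 = 2^-1 ^+ m - 2^-1 ^+ n :> R.
Proof.
move=> mn; rewrite big_add1 /= (eq_bigr (fun i => - 2^-1 ^+ i.+1 - (- 2^-1 ^+ i))).
  by rewrite telescope_sumr// opprK addrC.
by move=> i _; rewrite -exprVn exprS; lra.
Qed.

Let psum_nondec a : nondecreasing_seq (psum a).
Proof.
apply/nondecreasing_seqP => n; rewrite /psum [leRHS]big_nat_recr//= lerDl.
by rewrite divr_ge0// exprn_ge0.
Qed.

Let psum_le a m n : (m <= n)%N -> psum a n <= psum a m + 2^-1 ^+ m.
Proof.
move=> mn; rewrite /psum (@big_cat_nat _ _ _ m.+1)//= lerD2l.
apply: (@le_trans _ _ (2^-1 ^+ m - 2^-1 ^+ n)); last first.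
  by rewrite gerBl exprn_ge0// invr_ge0.
rewrite -geometric_half//; apply: ler_sum => j _.
by rewrite ler_piMl ?invr_ge0 ?exprn_ge0// lern1 leq_b1.
Qed.

Lemma binary_cvg a : psum a @ \oo --> binary R a.
Proof.
apply: nondecreasing_is_cvgn; first exact: psum_nondec.
exists 1 => _ [n _ <-]; apply: le_trans (psum_le a (leq0n n)) _.
by rewrite /psum big_geq// add0r expr0.
Qed.

Let psum_block a K : (forall k, const_block a (lv k).+1 (lv k.+1)) ->
  psum a (lv K) = \sum_(k < K) (a (lv k).+1)%:R * c k.
Proof.
move=> ab; elim: K => [|K IH]; first by rewrite lv0 big_ord0 /psum big_geq.
have lvK : (lv K <= lv K.+1)%N by apply: leq_trans (lvS K); rewrite leq_addr.
rewrite big_ord_recr /= -IH /psum (@big_cat_nat _ _ _ (lv K).+1)//=; congr (_ + _).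
rewrite -[c K]geometric_half// mulr_sumr; apply: eq_big_nat => j /andP[Kj jK].
rewrite (ab K j (lv K).+1)//; first by rewrite Kj.
by rewrite leqnn /= (leq_trans Kj).
Qed.

Let lv_ge k : (k <= lv k)%N.
Proof. by elim: k => // k /leq_ltn_trans; apply; apply: leq_trans (lvS k); rewrite addn2. Qed.

Let lv_homo j k : (j <= k)%N -> (lv j <= lv k)%N.
Proof.
apply: (homo_leq (r := fun i j => (i <= j)%N)) => // [? ? ?|i]; first exact: leq_trans.
by apply: leq_trans (lvS i); rewrite leq_addr.
Qed.

Let psum_lv_cvg a : (psum a \o lv) @ \oo --> binary R a.
Proof.
have lvoo : lv @ \oo --> \oo.
  by move=> A [N _ NA]; exists N => // k /= Nk; exact: NA (leq_trans Nk (lv_ge k)).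
exact: (cvg_comp _ _ lvoo (@binary_cvg a)).
Qed.

(** The digits of a point of the Cantor set are found greedily: [t k] is what
remains of [x] after [k] blocks. *)
Lemma binary_cantor :
  [set binary R a | a in [set a | forall k, const_block a (lv k).+1 (lv k.+1)]] = cantor 0.
Proof.
apply/seteqP; split=> [_ [a ab <-]|x Cx].
  pose s K : R := \sum_(k < K) (a (lv k).+1)%:R * c k.
  have sx k : 0 <= binary R a - s k <= r k.
    rewrite /s -psum_block// subr_ge0 lerBlDl; apply/andP; split.
      rewrite -(cvg_lim _ (@binary_cvg a))//; apply: limr_ge; first by apply/cvg_ex; eexists;
        exact: binary_cvg.
      by exists (lv k) => // n /= kn; exact: psum_nondec.
    rewrite -(cvg_lim _ (@binary_cvg a))//; apply: limr_le; first by apply/cvg_ex; eexists;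
      exact: binary_cvg.
    by exists (lv k) => // n /= kn; exact: psum_le.
  have st m : forall k, stage lv m k (binary R a - s k).
    elim: m => [|m IH] k /=; first by rewrite in_itv/=; exact: sx.
    have := IH k.+1; rewrite {1}/s big_ord_recr /= -/(s k).
    case: (a _); last by rewrite mul0r addr0; left.
    by rewrite mul1r opprD addrA; right.
  by move=> m _; have := st m 0%N; rewrite /s big_ord0 subr0.
pose t := fix t k := if k is j.+1 then
  (if r j.+1 < t j then t j - c j else t j) else x.
pose b k := r k.+1 < t k.
have tC k : cantor k (t k).
  elim: k => //= k; case: ltP => rk /(cantorE lvS)[] // H.
    by have := cantor_sub lvS H; lra.
  by have := cantor_sub lvS H; have := @gap_ge R lv lvS k; have := mesh_gt0 R lv k.+1; lra.
pose a j := `[< exists2 k, (lv k < j <= lv k.+1)%N & b k >].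
have aE k j : (lv k < j <= lv k.+1)%N -> a j = b k.
  move=> /andP[kj jk]; apply/asboolP/idP => [[i /andP[ij ji]]|bk]; last by exists k => //;
    rewrite kj.
  suff -> : i = k by [].
  apply/eqP; rewrite eqn_leq; apply/andP; split; rewrite leqNgt; apply/negP => /lv_homo H.
    by have := leq_trans ij (leq_trans jk H); rewrite ltnn.
  by have := leq_trans kj (leq_trans ji H); rewrite ltnn.
have ab k : const_block a (lv k).+1 (lv k.+1).
  by move=> i j ik jk; rewrite !(aE k).
exists a => //.
have xE k : psum a (lv k) = x - t k.
  rewrite psum_block//; elim: k => [|k IH]; first by rewrite big_ord0 subrr.
  rewrite big_ord_recr /= IH (aE k); last first.
    by rewrite ltnS leqnn /=; apply: leq_trans (lvS k); rewrite addn2 ltnS leqnSn.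
  by rewrite /b; case: ltP => _; rewrite ?mul1r ?mul0r; ring.
have t0 : t @ \oo --> 0.
  apply: (@squeeze_cvgr _ _ _ _ (fun=> 0) r).
  - by near=> k; exact: cantor_sub.
  - exact: cvg_cst.
  - exact: mesh_cvg0.
have : (psum a \o lv) @ \oo --> x.
  rewrite -[X in _ --> X]subr0; rewrite (_ : psum a \o lv = fun k => x - t k).
    by apply: cvgB => //; exact: cvg_cst.
  by apply/funext => k /=.
by move=> H; rewrite -(cvg_lim _ H)//; apply: esym; apply: cvg_lim; last exact: psum_lv_cvg.
Unshelve. all: by end_near. Qed.

End BinaryCantor.

(** * The graphoning of a Cantor set *)
Section LebesgueTranslation.
Variable R : realType.
Local Notation T := (measurableTypeR R).

Definition translate (s : R) : T -> T := fun x => x + s.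

Let measurable_translate s : measurable_fun setT (translate s).
Proof. by apply: measurable_funD => //; exact: measurable_cst. Qed.

HB.instance Definition _ s := isMeasurableFun.Build _ _ T T (translate s) (measurable_translate s).

Lemma lebesgue_measure_translate (s : R) (A : set T) : measurable A ->
  lebesgue_measure (translate s @^-1` A) = lebesgue_measure A.
Proof.
move=> mA; rewrite -[LHS]/(pushforward lebesgue_measure (translate s) A).
apply/esym/lebesgue_measure_unique => //= _ [[a b]] _ <-.
rewrite /pushforward (_ : translate s @^-1` _ = [set` `]a - s, b - s]]).
  by rewrite !lebesgue_measure_itv/= !lte_fin ltrD2r -!EFinB; congr (if _ then (_)%:E else _);
    ring.
by apply/seteqP; split=> x; rewrite /= !in_itv /translate /=; lra.
Qed.

End LebesgueTranslation.

Lemma integral_sections d1 d2 (T1 : measurableType d1) (T2 : measurableType d2)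
    (R : realType) (m1 : {sigma_finite_measure set T1 -> \bar R})
    (m2 : {sigma_finite_measure set T2 -> \bar R}) (A : set (T1 * T2)) :
  measurable A ->
  (\int[m1]_x (m2 \o xsection A) x = \int[m2]_y (m1 \o ysection A) y)%E.
Proof.
move=> mA; rewrite -(indic_fubini_tonelli_FE m2 mA) -(indic_fubini_tonelli_GE m1 mA).
exact: indic_fubini_tonelli.
Qed.

Section CantorGraphoning.
Variables (R : realType) (lv : nat -> nat) (h : R -> R).
Hypothesis hG : cantor_gauge lv h.
Local Notation T := (measurableTypeR R).
Implicit Types (x y s : T) (A B : set T).
Local Notation S := (@cantor R lv 0).
Local Notation mu := (hausdorff h).
Local Notation W := (W_of S).
Local Notation X01 := (@I01 R).
Let lv0 := cg_lv0 hG.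
Let lvS := cg_lvS hG.
Let h0 := cg_h0 hG.
Let h_mono := cg_mono hG.
Let h_cvg0 := cg_cvg0 hG.

Let Mex := hausdorff_measure_ex h0 h_mono h_cvg0.
Let M : {measure set T -> \bar R} := sval (cid Mex).
Let ME : (M : set T -> \bar R) = mu.
Proof. by rewrite /M; case: cid. Qed.

Let mS : measurable (S : set T).
Proof. exact: cantor_measurable. Qed.

Let S01 : S `<=` `[0, 1].
Proof. exact: cantor_sub01. Qed.

Lemma lebesgue_I01 : lebesgue_measure X01 = 1%E.
Proof. by rewrite /I01 lebesgue_measure_itv/= lte_fin ltr01 oppr0 adde0. Qed.

Definition nbhd x : set T := [set y | S `|x - y|].

Lemma W_indic x y : W x y = \1_(nbhd x) y.
Proof. by rewrite /W_of !indicE; congr (nat_of_bool _)%:R; apply/idP/idP; rewrite !inE. Qed.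

Lemma measurable_nbhd x : measurable (nbhd x).
Proof.
rewrite -[X in measurable X]setTI.
have : measurable_fun setT (fun y : T => `|x - y| : T).
  by apply: measurableT_comp => //; apply: measurable_funB => //; exact: measurable_cst.
by move=> /(_ measurableT _ mS).
Qed.

Lemma gdeg_nbhd A x : measurable A -> gdeg mu W A x = mu (nbhd x `&` A).
Proof.
move=> mA; rewrite /gdeg -ME (eq_integral (fun y => (\1_(nbhd x) y)%:E)).
  by rewrite integral_indic//; exact: measurable_nbhd.
by move=> y _; rewrite W_indic.
Qed.

Let mu_mono A B : A `<=` B -> (mu A <= mu B)%E.
Proof. exact: le_hausdorff. Qed.

(** Parametrizations by [S] of the points of [A] in [x + S] and in [x - S]. *)
Definition fwd x A : set T := S `&` [set s | A (x + s)].
Definition bwd x A : set T := S `&` [set s | A (x - s)].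

(** The sets [x + S] and [x - S] only share the null set [{x}], and [mu] is
invariant under translations and reflections. *)
Lemma nbhd_split x A : measurable A -> A `<=` X01 ->
  mu (nbhd x `&` A) = (mu (fwd x A) + mu (bwd x A))%E.
Proof.
move=> mA A01.
pose P := [set y : T | S (y - x) /\ A y].
pose Q := [set y : T | S (x - y) /\ A y].
have mP : measurable P.
  have : measurable_fun setT (fun y : T => y - x : T).
    by apply: measurable_funB => //; exact: measurable_cst.
  by move=> /(_ measurableT _ mS); rewrite setTI => mP; exact: measurableI.
have mQ : measurable Q.
  have : measurable_fun setT (fun y : T => x - y : T).
    by apply: measurable_funB => //; exact: measurable_cst.
  by move=> /(_ measurableT _ mS); rewrite setTI => mQ; exact: measurableI.
have PQ : nbhd x `&` A = P `|` (Q `\` [set x]).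
  have S0 z : S z -> 0 <= z by move=> /(cantor_sub lvS)/andP[].
  apply/seteqP; split=> [y [Sy Ay]|y [[Sy Ay]|[[Sy Ay] _]]].
  - have [xy|xy] := ltP y x; last first.
      by left; split=> //; move: Sy; rewrite /nbhd/= ler0_norm ?subr_le0// opprB.
    right; split; last by move=> yx; rewrite yx ltxx in xy.
    by split=> //; rewrite /nbhd/= gtr0_norm ?subr_gt0// in Sy.
  - by split=> //; rewrite /nbhd /= distrC ger0_norm// S0.
  - by split=> //; rewrite /nbhd /= ger0_norm// S0.
have muQ : mu (Q `\` [set x]) = mu Q.
  apply/eqP; rewrite eq_le; apply/andP; split; first by apply: mu_mono => ? [].
  apply: (@le_trans _ _ (mu ((Q `&` [set x]) `|` (Q `\` [set x])))).
    by apply: mu_mono => z Qz; have [zx|/eqP zx] := eqVneq z x; [left|right].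
  apply: le_trans (hausdorffU h0 h_mono _ _) _.
  rewrite (_ : mu (Q `&` [set x]) = 0%E) ?add0e; last first.
    apply: hausdorff_countable => //; first by move=> ? [[_ /A01]].
    by apply: sub_countable (countable1 x); apply: subset_card_le; exact: subIsetr.
  by [].
have mu_fwd : mu P = mu (fwd x A).
  apply/eqP; rewrite eq_le; apply/andP; split.
    apply: (@hausdorff_lipschitz _ _ h0 h_mono (fun s : R => s + x)).
    - by move=> y [_ /A01].
    - move=> y [Sy Ay]; exists (y - x); last by rewrite subrK.
      by split=> //=; rewrite addrC subrK.
    - by move=> u v; rewrite (_ : u + x - (v + x) = u - v)//; ring.
  apply: (@hausdorff_lipschitz _ _ h0 h_mono (fun s : R => s - x)).
  - by move=> s [/S01].
  - by move=> s [Ss As]; exists (x + s); [split=> //|]; rewrite /= addrAC subrr add0r.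
  - by move=> u v; rewrite (_ : u - x - (v - x) = u - v)//; ring.
have mu_bwd : mu Q = mu (bwd x A).
  have refl u v : `|x - u - (x - v)| <= `|u - v|.
    by rewrite distrC (_ : x - v - (x - u) = u - v)//; ring.
  apply/eqP; rewrite eq_le; apply/andP; split.
    apply: (@hausdorff_lipschitz _ _ h0 h_mono (fun s : R => x - s)) => //.
    - by move=> y [_ /A01].
    - move=> y [Sy Ay]; exists (x - y); last by rewrite opprB addrC subrK.
      by split=> //=; rewrite opprB addrC subrK.
  apply: (@hausdorff_lipschitz _ _ h0 h_mono (fun s : R => x - s)) => //.
  - by move=> s [/S01].
  - by move=> s [Ss As]; exists (x - s); [split=> //|]; rewrite /= opprB addrC subrK.
rewrite PQ -mu_fwd -mu_bwd -muQ -ME; apply: measureU => //.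
  by apply: measurableD => //; exact: measurable_set1.
apply/seteqP; split=> // y [[Sxy _] [[Syx _] yx]]; apply: yx => /=.
have /andP[yx _] := cantor_sub lvS Sxy; have /andP[xy _] := cantor_sub lvS Syx.
by apply/eqP; rewrite eq_le -subr_ge0 xy -subr_ge0 yx.
Qed.

Let Soo : (M S < +oo)%E.
Proof. by rewrite ME hausdorff_cantor0// ltry. Qed.

(** The restriction of [mu] to [S] is finite, which makes Tonelli's theorem
available. *)
Let MS : {finite_measure set T -> \bar R} := mfrestr mS Soo.

Let fwdE A : measurable A ->
  (fun x => mu (fwd x A)) = MS \o xsection [set z : T * T | A (z.1 + z.2)].
Proof.
move=> mA; apply/funext => x /=; rewrite /mfrestr /mrestr ME setIC; congr (mu (_ `&` _)).
by apply/seteqP; split=> s; rewrite /xsection /= inE.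
Qed.

Let bwdE A : measurable A ->
  (fun x => mu (bwd x A)) = MS \o xsection [set z : T * T | A (z.1 - z.2)].
Proof.
move=> mA; apply/funext => x /=; rewrite /mfrestr /mrestr ME setIC; congr (mu (_ `&` _)).
by apply/seteqP; split=> s; rewrite /xsection /= inE.
Qed.

Let mfwd A : measurable A -> measurable [set z : T * T | A (z.1 + z.2)].
Proof.
move=> mA; have : measurable_fun setT (fun z : T * T => z.1 + z.2 : T).
  by apply: measurable_funD; [exact: measurable_fst|exact: measurable_snd].
by move=> /(_ measurableT _ mA); rewrite setTI.
Qed.

Let mbwd A : measurable A -> measurable [set z : T * T | A (z.1 - z.2)].
Proof.
move=> mA; have : measurable_fun setT (fun z : T * T => z.1 - z.2 : T).
  by apply: measurable_funB; [exact: measurable_fst|exact: measurable_snd].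
by move=> /(_ measurableT _ mA); rewrite setTI.
Qed.

Lemma measurable_fwd A : measurable A -> measurable_fun setT (fun x => mu (fwd x A)).
Proof. by move=> mA; rewrite fwdE//; apply: measurable_fun_xsection; exact: mfwd. Qed.

Lemma measurable_bwd A : measurable A -> measurable_fun setT (fun x => mu (bwd x A)).
Proof. by move=> mA; rewrite bwdE//; apply: measurable_fun_xsection; exact: mbwd. Qed.

(** Both sides are the measure of the pairs of a point of [A] and a point
[s] of [S] with [x + s] in [B], computed by sections in the two orders: the
point of [A] may be replaced by the point [x + s] of [B] by invariance of
Lebesgue measure. *)
Lemma fwd_bwd A B : measurable A -> measurable B ->
  (\int[lebesgue_measure]_(x in A) mu (fwd x B) =
   \int[lebesgue_measure]_(x in B) mu (bwd x A))%E.
Proof.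
move=> mA mB.
pose EP := (A `*` setT) `&` [set z : T * T | B (z.1 + z.2)].
pose EM := (B `*` setT) `&` [set z : T * T | A (z.1 - z.2)].
have mEP : measurable EP by apply: measurableI; [exact: measurableX|exact: mfwd].
have mEM : measurable EM by apply: measurableI; [exact: measurableX|exact: mbwd].
have F1 := @integral_sections _ _ T T R lebesgue_measure MS EP mEP.
have F2 := @integral_sections _ _ T T R lebesgue_measure MS EM mEM.
transitivity (\int[lebesgue_measure]_x (MS \o xsection EP) x)%E.
  rewrite integral_mkcond; apply: eq_integral => x _; rewrite patchE.
  case: ifPn => xA.
    rewrite -[LHS]/((fun x => mu (fwd x B)) x) (fwdE mB) /=; congr mrestr; apply/seteqP;
      split=> s.
      by rewrite /xsection/= !inE/= => ?; split=> //; split=> //; rewrite inE in xA.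
    by rewrite /xsection/= !inE/= => -[].
  rewrite /= (_ : xsection EP x = set0) ?measure0//; apply/seteqP; split=> s //.
  by rewrite /xsection/= inE => -[[/= Ax _] _]; rewrite notin_setE in xA.
rewrite F1; symmetry; transitivity (\int[lebesgue_measure]_x (MS \o xsection EM) x)%E.
  rewrite integral_mkcond; apply: eq_integral => x _; rewrite patchE.
  case: ifPn => xA.
    rewrite -[LHS]/((fun x => mu (bwd x A)) x) (bwdE mA) /=; congr mrestr; apply/seteqP;
      split=> s.
      by rewrite /xsection/= !inE/= => ?; split=> //; split=> //; rewrite inE in xA.
    by rewrite /xsection/= !inE/= => -[].
  rewrite /= (_ : xsection EM x = set0) ?measure0//; apply/seteqP; split=> s //.
  by rewrite /xsection/= inE => -[[/= Ax _] _]; rewrite notin_setE in xA.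
rewrite F2; apply: eq_integral => s _ /=.
have mys : measurable (ysection EP s) by exact: measurable_ysection.
rewrite -(lebesgue_measure_translate (- s) mys); congr lebesgue_measure.
apply/seteqP; split=> x; rewrite /ysection /translate /= !inE /EP /EM /=.
  by move=> [[? _] ?]; rewrite subrK.
by rewrite subrK => -[[? _] ?].
Qed.

(** The part of [x - S] in the unit interval comes from the points of [S] up to
[x], which the reflection [s |-> 1 - s] turns into those from [1 - x] on; the
part of [x + S] comes from the points of [S] up to [1 - x]. *)
Lemma nbhd_full x : X01 x -> mu (nbhd x `&` X01) = 1%E.
Proof.
move=> Ix; rewrite nbhd_split//; last exact: measurable_itv.
rewrite -(hausdorff_cantor0 hG).
have x01 : 0 <= x <= 1 by move: Ix; rewrite /I01/= in_itv.
have -> : mu (bwd x X01) = mu (S `&` `[1 - x, 1]).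
  have Hsym : forall s, S s -> S (1 - s).
    by move=> s /cantor_sym; rewrite mesh0.
  have refl (u v : R) : `|1 - u - (1 - v)| <= `|u - v|.
    by rewrite distrC (_ : 1 - v - (1 - u) = u - v)//; ring.
  apply/eqP; rewrite eq_le; apply/andP; split.
    apply: (@hausdorff_lipschitz _ _ h0 h_mono (fun s : R => 1 - s)) => //.
    - by move=> y [/S01].
    - move=> s [Ss]; rewrite /I01/= in_itv /= => xs; exists (1 - s); last by rewrite subKr.
      split; first exact: Hsym.
      by have := cantor_sub lvS Ss; rewrite /= in_itv/=; lra.
  apply: (@hausdorff_lipschitz _ _ h0 h_mono (fun s : R => 1 - s)) => //.
  - by move=> y [/S01].
  - move=> s [Ss]; rewrite /= in_itv /= => xs; exists (1 - s); last by rewrite subKr.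
    split; first exact: Hsym.
    by have := cantor_sub lvS Ss; rewrite /I01/= in_itv/=; lra.
have -> : mu (fwd x X01) = mu (S `&` `[0, 1 - x[).
  have -> : fwd x X01 = (S `&` `[0, 1 - x[) `|` (S `&` [set 1 - x]).
    apply/seteqP; split=> s.
      move=> [Ss]; rewrite /I01/= in_itv /= => xs; have := cantor_sub lvS Ss.
      have [sx|sx|sx] := ltgtP s (1 - x : R); last by right.
        by left; split => //; rewrite in_itv/=; lra.
      by lra.
    move=> [[Ss]|[Ss]] /=; have := cantor_sub lvS Ss.
      by rewrite in_itv/=; split=> //; rewrite /I01/= in_itv/=; lra.
    by move=> ? sx; split=> //; rewrite /I01/= in_itv/= sx; lra.
  apply/eqP; rewrite eq_le; apply/andP; split; last by apply: mu_mono; exact: subsetUl.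
  apply: le_trans (hausdorffU h0 h_mono _ _) _.
  rewrite [X in (_ + X)%E](_ : _ = 0%E) ?adde0//.
  apply: hausdorff_countable => //; first by move=> ? [/S01].
  by apply: sub_countable (countable1 (1 - x)); apply: subset_card_le; exact: subIsetr.
rewrite -ME -measureU//.
- congr (M _); rewrite -setIUr; apply/seteqP; split=> [s []//|s Ss]; split=> //.
  have := cantor_sub lvS Ss; rewrite mesh0// /= !in_itv/=.
  by have [?|?] := ltP s (1 - x); [left|right]; lra.
- by apply: measurableI => //; exact: measurable_itv.
- by apply: measurableI => //; exact: measurable_itv.
apply/seteqP; split=> // s [[_ /=] + [_ /=]]; rewrite !in_itv/=; lra.
Qed.

Lemma cantor_graphoning : graphoning X01 lebesgue_measure mu W.
Proof.
have mI : measurable X01 by exact: measurable_itv.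
split; first exact: mI.
- split=> [|A mA _|A HA tA]; [exact: measure0|exact: measure_ge0|].
  apply: measure_semi_sigma_additive => //; first by move=> i; exact: (HA i).1.
  by apply: bigcup_measurable => i _; exact: (HA i).1.
- exact: lebesgue_I01.
- rewrite -ME; split=> [|A mA _|A HA tA]; [exact: measure0|exact: measure_ge0|].
  apply: measure_semi_sigma_additive => //; first by move=> i; exact: (HA i).1.
  by apply: bigcup_measurable => i _; exact: (HA i).1.
- by move=> x y _ _; rewrite W_indic indicE ler0n lern1 leq_b1.
- by move=> x y _ _; rewrite /W_of distrC.
- apply: measurable_funTS; apply: (@measurableT_comp _ _ _ _ _ _ (\1_S : T -> R) _ (fun z : T * T => `|z.1 - z.2| : T)).
    exact: measurable_indic.
  apply: measurableT_comp => //; apply: measurable_funB;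
    [exact: measurable_fst|exact: measurable_snd].
- by move=> x Ix; rewrite (gdeg_nbhd _ mI) (nbhd_full Ix).
- move=> A mA A01; rewrite (_ : gdeg _ _ _ = fun x => (mu (fwd x A) + mu (bwd x A))%E);
  last first.
    by apply/funext => x; rewrite (gdeg_nbhd _ mA) (nbhd_split _ mA A01).
  apply: measurable_funTS; apply: emeasurable_funD;
    [exact: measurable_fwd|exact: measurable_bwd].
- move=> A B mA A01 mB B01.
  have Hs C D : measurable C -> measurable D -> D `<=` X01 ->
      (\int[lebesgue_measure]_(x in C) gdeg mu W D x =
       \int[lebesgue_measure]_(x in C) mu (fwd x D) +
       \int[lebesgue_measure]_(x in C) mu (bwd x D))%E.
    move=> mC mD D01; rewrite -(ge0_integralD _ mC).
    + by apply: eq_integral => x _; rewrite (gdeg_nbhd _ mD) (nbhd_split _ mD D01).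
    + by move=> x _; exact: hausdorff_ge0.
    + by apply: measurable_funTS; exact: measurable_fwd.
    + by move=> x _; exact: hausdorff_ge0.
    + by apply: measurable_funTS; exact: measurable_bwd.
  by rewrite (Hs _ _ mA mB B01) (Hs _ _ mB mA A01) (fwd_bwd mA mB) (fwd_bwd mB mA) addeC.
Qed.

End CantorGraphoning.

(** * Densities in a regular graphoning with null codegrees *)
Section IntegralNonneg.
Context d (T : measurableType d) (R : realType).
Variable M : {measure set T -> \bar R}.
Local Open Scope ereal_scope.
Import HBNNSimple.

(** Stated for arbitrary functions, since the inner iterated integrals are not
known to be measurable. *)
Lemma le_integral_ge0 (X : set T) (f g : T -> \bar R) :
  (forall x, X x -> 0 <= f x) -> (forall x, X x -> f x <= g x) ->
  \int[M]_(x in X) f x <= \int[M]_(x in X) g x.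
Proof.
move=> f0 fg; rewrite !ge0_integralE//; last first.
  by move=> x Xx; apply: le_trans (f0 _ Xx) (fg _ Xx).
apply: ge_ereal_sup => _ [k /= kf <-]; apply: ereal_sup_ubound; exists k => //= x.
apply: le_trans (kf x) _; rewrite !patchE; case: ifPn => //.
by rewrite inE => /fg.
Qed.

Lemma integral_null_support (X C : set T) (f : T -> \bar R) :
  measurable C -> M C = 0 -> (forall x, X x -> 0 <= f x) ->
  (forall x, X x -> ~ C x -> f x = 0) -> \int[M]_(x in X) f x = 0.
Proof.
move=> mC MC0 f0 fC; apply/eqP; rewrite eq_le integral_ge0// andbT.
rewrite ge0_integralE//; apply: ge_ereal_sup => _ [k /= kf <-].
rewrite sintegralE fsbig1// => r _.
have [->|r0] := eqVneq r 0%R; first by rewrite mul0e.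
rewrite (_ : M (k @^-1` [set r]) = 0) ?mule0//.
apply: (subset_measure0 _ mC) => // x /= kx; apply: contrapT => nC.
have r_ge0 : (0 <= r)%R by rewrite -kx; exact: fun_ge0.
suff : (r%:E <= 0)%E by rewrite lee_fin => r_le0; move/eqP: r0; apply; apply: le_anti;
  rewrite r_le0.
have := kf x; rewrite kx patchE; case: ifPn => // /set_mem Xx.
by rewrite fC.
Qed.

End IntegralNonneg.

(** The hypothesis [Wcodeg] says that the common neighbourhood of [x] and [y] is
null for almost all [y]. *)
Section GraphoningDensity.
Context (R : realType) (dT : measure_display) (T : measurableType dT).
Variables (X : set T) (mX : measurable X) (lam M : {measure set T -> \bar R}).
Variable W : T -> T -> R.
Hypothesis lamX : lam X = 1%E.
Hypothesis W01 : forall x y, 0 <= W x y <= 1.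
Hypothesis Wm : forall x, measurable_fun X (W x).
Hypothesis Wdeg : forall x, X x -> (\int[M]_(y in X) (W x y)%:E = 1)%E.
Hypothesis Wcodeg : forall x, X x -> exists C, [/\ measurable C, M C = 0%E &
  forall y, X y -> ~ C y -> (\int[M]_(z in X) (W x z * W y z)%:E = 0)%E].
Variables (F : sgraph) (lab : F -> 'I_(nv F)).
Hypothesis Fconn : connected_graph F.
Hypothesis Hlab : exploration lab.
Local Notation n := (nv F).
Implicit Types (x : nat -> T) (i m : nat) (v : F) (y : T).

(** Grouping the edges by their later end, so that the innermost variable
occurs in one factor only. *)
Let fac v x : R := \prod_(u in back lab v) W (x (lab u)) (x (lab v)).
Let pp m x : R := \prod_(v | (lab v < m)%N) fac v x.
Let eprod x : \bar R := (edge_prod W lab x)%:E.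

Let edge_prodE x : edge_prod W lab x = pp n x.
Proof.
rewrite /edge_prod (exchange_big_dep xpredT) //= /pp; apply: eq_big => v.
  by rewrite ltn_ord.
by move=> _; rewrite /fac; apply: eq_bigl => u; rewrite inE.
Qed.

Let upd x m y : nat -> T := [eta x with m |-> y].

Let upd_lt x m y j : (j < m)%N -> upd x m y j = x j.
Proof. by move=> jm; rewrite /upd /= ltn_eqF. Qed.

Let upd_eq x m y : upd x m y m = y.
Proof. by rewrite /upd /= eqxx. Qed.

Let prodW01 (I : finType) (Q : pred I) (w : I -> R) :
  (forall a, 0 <= w a <= 1) -> 0 <= \prod_(a | Q a) w a <= 1.
Proof.
move=> w01; rewrite prodr_ge0/=; last by move=> a _; case/andP: (w01 a).
by apply: prodr_ile1 => a _; exact: w01.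
Qed.

Let fac01 v x : 0 <= fac v x <= 1.
Proof. by apply: prodW01 => u. Qed.

Let pp01 m x : 0 <= pp m x <= 1.
Proof. by apply: prodW01 => u; exact: fac01. Qed.

Let ppS m x y v : lab v = m :> nat ->
  pp m.+1 (upd x m y) = pp m x * \prod_(u in back lab v) W (x (lab u)) y.
Proof.
move=> vm; rewrite /pp (bigD1 v)/= ?vm// mulrC; congr (_ * _); last first.
  rewrite /fac; apply: eq_bigr => u; rewrite inE vm => /andP[_ um].
  by rewrite upd_lt// upd_eq.
have ltm w : (lab w < m.+1)%N && (w != v) = (lab w < m)%N.
  rewrite ltnS leq_eqVlt; have [->|wv] := eqVneq w v; first by rewrite vm ltnn andbF.
  rewrite andbT -vm (_ : (_ == _ :> nat) = false)//;
    apply/eqP => /val_inj /(bij_inj Hlab.1) wv'.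
  by rewrite wv' eqxx in wv.
apply: eq_big => // w; rewrite ltm => wm; apply: eq_bigr => u; rewrite inE => /andP[_ uw].
by rewrite !upd_lt// (ltn_trans uw).
Qed.

Let at_label m : (m < n)%N -> exists v, lab v = m :> nat.
Proof.
by move=> lin; have [la H1 H2] := Hlab.1; exists (la (Ordinal lin)); rewrite H2.
Qed.

Let n_gt0 : (0 < n)%N.
Proof.
rewrite lt0n; apply/eqP => n0; have : connected_graph F by [].
by rewrite /connected_graph /nc /n_comp_mem eq_card0// => v; have := max_card (pred1 v);
  rewrite card1 -[#|F|]/(nv F) n0.
Qed.

Let back_neq0 v : (0 < lab v)%N -> exists2 u, adj u v & (lab u < lab v)%N.
Proof.
move=> v0; case: (Hlab.2 v) => [/finset.set0Pn[u]|H]; first by rewrite inE => /andP[]; exists u.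
have [w w0] := at_label n_gt0; have /H : (lab w < lab v)%N by rewrite w0.
by rewrite connected_connect.
Qed.

Let iter_ge0 i : forall m x, (0 <= iter_int X M i m x eprod)%E.
Proof.
elim: i => [|i IH] m x /=; last by apply: integral_ge0 => y _; exact: IH.
by rewrite lee_fin edge_prodE; case/andP: (pp01 n x).
Qed.

Let inX m x := forall j, (j < m)%N -> X (x j).

Let inX_upd m x y : inX m x -> X y -> inX m.+1 (upd x m y).
Proof.
move=> xX Xy j; rewrite ltnS leq_eqVlt => /orP[/eqP ->|jm]; first by rewrite upd_eq.
by rewrite upd_lt//; exact: xX.
Qed.

Let intW c z : 0 <= c -> X z -> (\int[M]_(y in X) (c * W z y)%:E = c%:E)%E.
Proof.
move=> c0 Xz; under eq_integral do rewrite EFinM.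
rewrite ge0_integralZl_EFin// ?Wdeg ?mule1//.
  by move=> y _; rewrite lee_fin; case/andP: (W01 z y).
by apply/measurable_EFinP; exact: Wm.
Qed.

(** Each remaining variable is integrated against at least one edge to an earlier
one, whose degree is 1; the other edges are bounded by 1. *)
Let iter_le i : forall m x, (0 < m)%N -> (i + m)%N = n -> inX m x ->
  (iter_int X M i m x eprod <= (pp m x)%:E)%E.
Proof.
elim: i => [|i IH] m x m0 imn xX /=; first by rewrite /eprod edge_prodE -imn.
have [v vm] : exists v, lab v = m :> nat by apply: at_label; rewrite -imn addSn ltnS leq_addl.
have [u uv luv] : exists2 u, adj u v & (lab u < lab v)%N by apply: back_neq0; rewrite vm.
have Xu : X (x (lab u)) by apply: xX; rewrite -vm.
rewrite -(intW _ Xu); last by case/andP: (pp01 m x).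
apply: le_integral_ge0 => [y _|y Xy]; first exact: iter_ge0.
apply: (le_trans (IH m.+1 (upd x m y) _ _ (inX_upd xX Xy))) => //; first by rewrite addnS.
rewrite lee_fin (ppS _ _ vm) ler_wpM2l//; first by case/andP: (pp01 m x).
rewrite (bigD1 u) ?inE ?uv//= ler_piMr//; first by case/andP: (W01 (x (lab u)) y).
by have /andP[] := @prodW01 _ (fun a => (a \in back lab v) && (a != u)) (fun a => W (x (lab a)) y) (fun=> W01 _ _).
Qed.

Let iter_forest i : (forall v, (#|back lab v| <= 1)%N) ->
  forall m x, (0 < m)%N -> (i + m)%N = n -> inX m x ->
  (iter_int X M i m x eprod = (pp m x)%:E)%E.
Proof.
move=> b1; elim: i => [|i IH] m x m0 imn xX /=; first by rewrite /eprod edge_prodE -imn.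
have [v vm] : exists v, lab v = m :> nat by apply: at_label; rewrite -imn addSn ltnS leq_addl.
have [u uv luv] : exists2 u, adj u v & (lab u < lab v)%N by apply: back_neq0; rewrite vm.
have Xu : X (x (lab u)) by apply: xX; rewrite -vm.
rewrite -(intW _ Xu); last by case/andP: (pp01 m x).
apply: eq_integral => y /set_mem Xy.
rewrite -[X in iter_int _ _ _ _ X]/(upd x m y) IH//; [|by rewrite addnS|exact: inX_upd].
rewrite (ppS _ _ vm); congr (_ * _)%:E; rewrite (_ : back lab v = [set u]%SET) ?big_set1//.
apply/eqP; rewrite eq_sym finset.eqEcard finset.sub1set inE uv luv/= cards1.
exact: b1.
Qed.

(** The variable of [v] is integrated against the edges to [u] and [w], which
gives 0 unless the variable of [w] lies in a null set that depends on the
variable of [u]. Claim [A] is this step, claimed for all variables between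
those of [w] and [v]. *)
Let iter_cyclic0 v u w : u \in back lab v -> w \in back lab v -> (lab u < lab w)%N ->
  forall i m x, (0 < m)%N -> (i + m)%N = n -> inX m x -> (m <= lab w)%N ->
  (iter_int X M i m x eprod = 0)%E.
Proof.
move=> uv wv uw.
have [luv lwv] : (lab u < lab v)%N /\ (lab w < lab v)%N.
  by move: uv wv; rewrite !inE => /andP[_ ->] /andP[_ ->].
have A i : forall m x, (lab w < m <= lab v)%N -> (i + m)%N = n -> inX m x ->
    (\int[M]_(z in X) (W (x (lab u)) z * W (x (lab w)) z)%:E = 0)%E ->
    (iter_int X M i m x eprod = 0)%E.
  elim: i => [|i IH] m x /andP[wm mv] imn xX Hx.
    by have := ltn_ord (lab v); rewrite ltnNge => /negP[]; rewrite -[X in (X <= _)%N]imn.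
  have [mv'|mv'] := ltnP m (lab v).
    rewrite /= (eq_integral (cst 0%E)) ?integral0// => y /set_mem Xy.
    apply: (IH m.+1 (upd x m y)); [by rewrite leqW|by rewrite addnS|exact: inX_upd|].
    by rewrite !upd_lt// (ltn_trans uw).
  have vm : lab v = m :> nat by apply/eqP; rewrite eqn_leq mv mv'.
  apply/eqP; rewrite eq_le iter_ge0 andbT -Hx /=.
  apply: le_integral_ge0 => [y _|y Xy]; first exact: iter_ge0.
  apply: (le_trans (iter_le _ _ (inX_upd xX Xy))) => //; first by rewrite addnS.
  rewrite lee_fin (ppS _ _ vm).
  have /andP[p0 p1] := pp01 m x; apply: (@le_trans _ _ (1 * \prod_(a in back lab v) W (x (lab a)) y)).
    rewrite ler_wpM2r//; have /andP[]// := @prodW01 _ (fun a => a \in back lab v) (fun a => W (x (lab a)) y) (fun=> W01 _ _).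
  rewrite mul1r (bigD1 u)//= ler_wpM2l//; first by case/andP: (W01 (x (lab u)) y).
  rewrite (bigD1 w)/=; last by rewrite wv; apply/eqP => wu; rewrite wu ltnn in uw.
  rewrite ler_piMr//; first by case/andP: (W01 (x (lab w)) y).
  by have /andP[] := @prodW01 _ (fun a => (a \in back lab v) && (a != u) && (a != w)) (fun a => W (x (lab a)) y) (fun=> W01 _ _).
elim=> [|i IH] m x m0 imn xX mw.
  by have := ltn_ord (lab w); rewrite ltnNge => /negP[]; rewrite -[X in (X <= _)%N]imn.
move: mw; rewrite leq_eqVlt => /orP[/eqP mw|mw]; last first.
  rewrite /= (eq_integral (cst 0%E)) ?integral0// => y /set_mem Xy.
  by apply: (IH m.+1 (upd x m y)); [|rewrite addnS|exact: inX_upd|].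
have Xu : X (x (lab u)) by apply: xX; rewrite mw.
have [C [mC MC HC]] := Wcodeg Xu.
apply: (integral_null_support mC MC) => [y _|y Xy nCy]; first exact: iter_ge0.
apply: (A _ m.+1 (upd x m y)); [by rewrite mw ltnSn|by rewrite addnS|exact: inX_upd|].
have -> : upd x m y (lab w) = y by rewrite -mw upd_eq.
by rewrite upd_lt ?mw//; exact: HC.
Qed.

Let pp1 x : pp 1 x = 1.
Proof.
rewrite /pp big1// => v; rewrite ltnS leqn0 => /eqP v0.
by rewrite /fac big1// => u; rewrite inE v0 ltn0 andbF.
Qed.

Let n1 : (n.-1 + 1)%N = n.
Proof. by rewrite addn1 prednK. Qed.

Lemma graphoning_density_forest : (forall v, (#|back lab v| <= 1)%N) ->
  graphoning_density X lam M W lab = 1%E.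
Proof.
move=> b1; rewrite /graphoning_density (eq_integral (cst 1%E)); last first.
  by move=> y /set_mem Xy; rewrite -[LHS]/(iter_int X M n.-1 1 (fun=> y) eprod) iter_forest// pp1.
by rewrite integral_cst// mul1e.
Qed.

Lemma graphoning_density_cyclic : (exists v, (1 < #|back lab v|)%N) ->
  graphoning_density X lam M W lab = 0%E.
Proof.
move=> [v /card_gt1P[u0 [w0 [u0x w0x uw0]]]].
have [u [w [uv wv uw]]] : exists u w, [/\ u \in back lab v, w \in back lab v & (lab u < lab w)%N].
  have [|wu|/val_inj/(bij_inj Hlab.1) uw] := ltngtP (lab u0) (lab w0); first by exists u0, w0.
    by exists w0, u0.
  by rewrite uw eqxx in uw0.
rewrite /graphoning_density (eq_integral (cst 0%E)) ?integral0// => y /set_mem Xy.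
by apply: (iter_cyclic0 uv wv uw) => //; exact: leq_ltn_trans (leq0n _) uw.
Qed.

End GraphoningDensity.

(** * Convergence to the graphoning of a Cantor set *)
Section HomDensityLimit.
Variables (R : realType) (F : sgraph) (lab : F -> 'I_(nv F)).
Hypothesis Hlab : exploration lab.

Lemma hom_density_forest (G : sgraph) d : sparse_regular G d ->
  (forall v, (#|back lab v| <= 1)%N) -> hom_density R F G d = 1.
Proof.
move=> [d0 N0 degG _] b1; rewrite /hom_density (hom_forest Hlab degG N0 b1).
by rewrite natrM !natrX divff// mulf_neq0// expf_neq0// pnatr_eq0 -lt0n.
Qed.

Lemma hom_density_cyclic (G : sgraph) d : sparse_regular G d ->
  (exists v, (1 < #|back lab v|)%N) -> hom_density R F G d <= 3 / d%:R.
Proof.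
move=> [d0 N0 degG codeg] b2; have H := hom_cyclic Hlab degG N0 d0 codeg b2.
rewrite /hom_density ler_pdivrMr ?mulr_gt0 ?exprn_gt0 ?ltr0n//.
rewrite mulrAC ler_pdivlMr ?ltr0n//.
by rewrite -(ler_nat R) !natrM !natrX in H.
Qed.

Lemma hom_density_cvg (G : nat -> sgraph) (d : nat -> nat) :
  (forall n, sparse_regular (G n) (d n)) -> d @ \oo --> \oo ->
  hom_density R F (G n) (d n) @[n --> \oo] -->
    ((if [forall v, (#|back lab v| <= 1)%N] then 1 else 0) : R).
Proof.
move=> HG doo; case: ifPn => [/forallP b1|].
  under eq_fun do rewrite hom_density_forest//.
  exact: cvg_cst.
rewrite negb_forall => /existsP[v]; rewrite -ltnNge => bv.
apply: (@squeeze_cvgr _ _ _ _ (fun=> 0) (fun n => 3 * (d n)%:R^-1)).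
- near=> n; rewrite hom_density_cyclic//=; last by exists v.
  by rewrite andbT divr_ge0// mulr_ge0// exprn_ge0.
- exact: cvg_cst.
rewrite -[X in _ --> X](mulr0 3); apply: cvgM; first exact: cvg_cst.
apply/cvgrPdist_lt => e e0.
have [N HN] : exists N : nat, (e^-1 < N%:R)%R.
  by exists (Num.truncn e^-1).+1; exact: truncnS_gt.
near=> n; rewrite sub0r normrN ger0_norm ?invr_ge0// invf_plt ?posrE//; last first.
  by rewrite ltr0n; have [] := HG n.
apply: lt_le_trans HN _; rewrite ler_nat; near: n.
by apply: (doo [set k | (N <= k)%N]); exists N.
Unshelve. all: by end_near. Qed.

End HomDensityLimit.

Lemma hom_density_is_cvg (R : realType) (G : nat -> sgraph) (d : nat -> nat) :
  (forall n, sparse_regular (G n) (d n)) -> d @ \oo --> \oo -> convergent R G d.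
Proof.
move=> HG doo F; have [lab Hlab] := exploration_exists F.
by apply/cvg_ex; eexists; exact: (@hom_density_cvg R F lab Hlab G d HG doo).
Qed.

Section CantorLimit.
Variables (R : realType) (lv : nat -> nat) (h : R -> R).
Hypothesis hG : cantor_gauge lv h.
Local Notation T := (measurableTypeR R).
Implicit Types (x y z : T).
Local Notation S := (@cantor R lv 0).
Local Notation mu := (hausdorff h).
Local Notation W := (W_of S).
Local Notation X01 := (@I01 R).
Let lv0 := cg_lv0 hG.
Let lvS := cg_lvS hG.
Let h0 := cg_h0 hG.
Let h_mono := cg_mono hG.
Let h_cvg0 := cg_cvg0 hG.

(** A translate of the intersection of [S] with [S + (q - p)]. *)
Let shift_cap (p q : R) : ~ rationals (q - p) ->
  mu [set z | X01 z /\ S (z - p) /\ S (z - q)] = 0%E.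
Proof.
move=> pq; apply/eqP; rewrite eq_le hausdorff_ge0// andbT -(hausdorff_selfcap hG pq).
apply: (@hausdorff_lipschitz _ _ h0 h_mono (fun s : R => s + p)).
- by move=> z [].
- move=> z [_ [Sp Sq]]; exists (z - p); last by rewrite subrK.
  by split=> //=; rewrite (_ : z - p - (q - p) = z - q)//; ring.
- by move=> u v; rewrite (_ : u + p - (v + p) = u - v)//; ring.
Qed.

(** By symmetry of [S], a neighbour of [x] lies in [x + S] or in [x - 1 + S];
so the intersection is covered by four intersections of translates of [S], with
irrational differences. *)
Lemma nbhd_cap_null x y : ~ rationals (y - x) ->
  mu (nbhd lv x `&` nbhd lv y `&` X01) = 0%E.
Proof.
move=> xy.
pose K (p q : R) := [set z : T | X01 z /\ S (z - p) /\ S (z - q)].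
have fold (a z : T) : nbhd lv a z -> S (z - a) \/ S (z - (a - 1)).
  rewrite /nbhd /=; have [az|az] := leP a z.
    by rewrite ler0_norm ?subr_le0// opprB; left.
  rewrite gtr0_norm ?subr_gt0// => /cantor_sym; rewrite mesh0// => H; right.
  by rewrite (_ : z - (a - 1) = 1 - (a - z))//; ring.
have Q1 : rationals (1 : R) := rationals1 R.
have K0 p q : ~ rationals (q - p) -> mu (K p q) = 0%E by exact: shift_cap.
have k1 : mu (K x y) = 0%E by exact: K0.
have k2 : mu (K x (y - 1)) = 0%E.
  apply: K0 => H; apply: xy; rewrite (_ : y - x = (y - 1 - x) + 1); last by ring.
  exact: rationalsD.
have k3 : mu (K (x - 1) y) = 0%E.
  apply: K0 => H; apply: xy; rewrite (_ : y - x = (y - (x - 1)) - 1); last by ring.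
  by apply: rationalsD => //; exact: rationalsN.
have k4 : mu (K (x - 1) (y - 1)) = 0%E.
  by apply: K0 => H; apply: xy; rewrite (_ : y - x = y - 1 - (x - 1))//; ring.
apply/eqP; rewrite eq_le hausdorff_ge0// andbT.
apply: (@le_trans _ _ (mu ((K x y `|` K x (y - 1)) `|` (K (x - 1) y `|` K (x - 1) (y - 1))))).
  apply: le_hausdorff => // z [[/fold nx /fold ny] Iz].
  by case: nx => nx; case: ny => ny; [left; left|left; right|right; left|right; right].
apply: le_trans (hausdorffU h0 h_mono _ _) _.
apply: (@le_trans _ _ (0 + 0)%E); last by rewrite adde0.
apply: leeD; apply: le_trans (hausdorffU h0 h_mono _ _) _.
  by rewrite -[X in (X + _)%E]/(mu (K x y)) k1 -[X in (_ + X)%E]/(mu (K x (y - 1))) k2 adde0.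
by rewrite -[X in (X + _)%E]/(mu (K (x - 1) y)) k3 -[X in (_ + X)%E]/(mu (K (x - 1) (y - 1))) k4 adde0.
Qed.

Lemma cantor_density (F : sgraph) (lab : F -> 'I_(nv F)) :
  connected_graph F -> exploration lab ->
  graphoning_density X01 lebesgue_measure mu W lab =
    (if [forall v, (#|back lab v| <= 1)%N] then 1%E else 0%E).
Proof.
move=> Fc Hlab; have [M ME] := hausdorff_measure_ex h0 h_mono h_cvg0.
have mX : measurable X01 by exact: measurable_itv.
have W01 x y : 0 <= W x y <= 1.
  by rewrite W_indic indicE ler0n lern1 leq_b1.
have Wm x : measurable_fun X01 (W x).
  rewrite (_ : W x = \1_(nbhd lv x)); last by apply/funext => y; rewrite W_indic.
  by apply: measurable_funTS; apply: measurable_indic; exact: measurable_nbhd.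
have Wdeg x : X01 x -> (\int[M]_(y in X01) (W x y)%:E = 1)%E.
  move=> Xx; rewrite -(nbhd_full hG Xx) -(gdeg_nbhd hG _ mX).
  by rewrite /gdeg ME.
have Wcodeg x : X01 x -> exists C, [/\ measurable C, M C = 0%E &
    forall y, X01 y -> ~ C y -> (\int[M]_(z in X01) (W x z * W y z)%:E = 0)%E].
  move=> Xx; pose C := [set y : T | X01 y /\ rationals (y - x)].
  have cC : countable C.
    pose D := (fun q : rat => x + ratr q) @` [set: rat].
    have CD : C `<=` D.
      by move=> y [_ [q _ qE]]; exists q => //; rewrite qE addrC subrK.
    apply: (sub_countable (subset_card_le CD)).
    by apply: (sub_countable (card_image_le _ _)); exact: countableP.
  exists C; split.
  - by apply: countable_measurable => // t; exact: measurable_set1.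
  - by rewrite ME; apply: hausdorff_countable => // y [].
  - move=> y Xy nC; rewrite (eq_integral (fun z => (\1_(nbhd lv x `&` nbhd lv y) z)%:E)).
      rewrite integral_indic//; last by apply: measurableI; exact: measurable_nbhd.
      by rewrite ME; apply: nbhd_cap_null => H; apply: nC.
    by move=> z _; rewrite !W_indic indicI.
rewrite -ME; case: ifPn => [/forallP b1|].
  exact: (graphoning_density_forest mX (lebesgue_I01 R) W01 Wm Wdeg Fc Hlab b1).
rewrite negb_forall => /existsP[v]; rewrite -ltnNge => bv.
by apply: (graphoning_density_cyclic mX lebesgue_measure W01 Wm Wdeg Wcodeg Fc Hlab); exists v.
Qed.

Theorem cantor_euclidean_limit (G : nat -> sgraph) (d : nat -> nat) :
  (forall n, sparse_regular (G n) (d n)) -> d @ \oo --> \oo ->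
  (fun n => h (1 / (nv (G n))%:R)) ~_\oo (fun n => 1 / (d n)%:R : R) ->
  euclidean_limit G d mu W.
Proof.
move=> HG doo asym; split.
- by move=> n; have [d0 _ degG _] := HG n; split=> // x; rewrite degG.
- exact: hom_density_is_cvg.
- exists h; split=> //; split=> //; first exact: cantor_graphoning.
  exists 1 => //; split=> [x /andP[x0 x1]|x y x0 xy y1|].
  + exact: (cg_ge0 hG).
  + exact: h_mono.
  + exact: cg_rc hG.
- move=> F Fc lab /admissible_exploration Hlab; rewrite cantor_density//.
  have := @hom_density_cvg R F lab Hlab G d HG doo.
  by case: ifP => _ H; apply: cvg_EFin => //; exact: nearW.
Qed.

End CantorLimit.

(** * The gauge and the digit blocks of projective planes *)
Section ProjGauge.
Variable R : realType.
Implicit Types (x y a b : R).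

(** The ends 0, 3, 5, 7, ... of the digit blocks. *)
Definition lv_proj k : nat := if k is 0 then 0 else (2 * k + 1)%N.

Lemma proj_cantor_gauge : cantor_gauge lv_proj (@h_proj R).
Proof.
have lvS k : (lv_proj k + 2 <= lv_proj k.+1)%N by rewrite /lv_proj; case: k => [|k]; lia.
split=> //.
- by rewrite /h_proj mulr0 sqrtr0.
- by move=> x y x0 xy _; rewrite /h_proj ler_sqrt ?ler_pM2l// mulr_ge0// (le_trans x0).
- move=> x _; rewrite /h_proj; apply: cvg_at_right_filter.
  apply: (@cvg_comp _ _ _ (fun y => 2 * y) Num.sqrt _ (nbhs (2 * x))).
    by apply: cvgM; [exact: cvg_cst|exact: cvg_id].
  exact: sqrt_continuous.
- move=> k; rewrite /h_proj /mesh /lv_proj addn1 exprS mulrA divff// mul1r.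
  by rewrite mulnC exprM sqrtr_sqr ger0_norm// exprn_ge0// invr_ge0.
exists 4^-1; first by rewrite invr_gt0 ltr0n lexx.
move=> k a b _ /andP[a0 a1] /andP[b0 b1]; have := @meshS R lv_proj lvS k.
set u := mesh _ _ k; set v := mesh _ _ k.+1 in a1 b1 * => uv.
rewrite /h_proj.
have a2 : 0 <= 2 * a by rewrite mulr_ge0.
have b2 : 0 <= 2 * b by rewrite mulr_ge0.
rewrite -[leLHS]ger0_norm ?addr_ge0 ?sqrtr_ge0// -sqrtr_sqr ler_sqrt; last by lra.
rewrite sqrrD !sqr_sqrtr//.
have : 0 <= (Num.sqrt (2 * a) - Num.sqrt (2 * b)) ^+ 2 by rewrite sqr_ge0.
by rewrite sqrrB !sqr_sqrtr//; lra.
Qed.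

Lemma S_projE : @S_proj R = @cantor R lv_proj 0.
Proof.
rewrite -binary_cantor//; last by move=> k; rewrite /lv_proj; case: k => [|k]; lia.
congr (_ @` _); apply/seteqP; split=> a /=.
  move=> [a0 ai] [|k]; first by [].
  by have := ai k.+2 isT; rewrite /lv_proj (_ : (2 * k.+1 + 1).+1 = 2 * k.+2)%N//; lia.
move=> H; split=> [|[|[|i]] // _]; first exact: (H 0%N).
by have := H i.+1; rewrite /lv_proj (_ : (2 * i.+1 + 1).+1 = 2 * i.+2)%N//; lia.
Qed.

(** The two sides are [1 / sqrt (q^2 + q + 1)] and [1 / (q + 1)], and the
former exceeds the latter by a factor of at most [1 + 1 / q]. *)
Lemma h_proj_asym (q : nat -> nat) : q @ \oo --> \oo ->
  (fun n => @h_proj R (1 / (2 * (q n * q n + q n + 1))%:R)) ~_\oo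
  (fun n => 1 / (q n).+1%:R : R).
Proof.
move=> qoo; apply/eqaddoP => e e0.
have [N HN] : exists N : nat, (e^-1 < N%:R)%R.
  by exists (Num.truncn e^-1).+1; exact: truncnS_gt.
near=> n.
have qN : (N.+1 <= q n)%N by near: n; apply: (qoo [set k | (N.+1 <= k)%N]); exists N.+1.
have eq : e^-1 < (q n)%:R by apply: lt_trans HN _; rewrite ltr_nat.
rewrite !fctE /h_proj; set Q : R := (q n)%:R in eq *.
have Q0 : 0 < Q by rewrite ltr0n (leq_trans _ qN).
have -> : (q n).+1%:R = Q + 1 :> R by rewrite -natr1.
have -> : 2 * (1 / (2 * (q n * q n + q n + 1))%:R) = (Q ^+ 2 + Q + 1)^-1 :> R.
  rewrite natrM !natrD natrM -/Q -expr2 invfM; field.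
  by have := sqr_ge0 Q; rewrite expr2; lra.
set V := Q ^+ 2 + Q + 1; have V0 : 0 < V by rewrite /V; have := sqr_ge0 Q; lra.
set s := Num.sqrt V^-1; have s0 : 0 < s by rewrite sqrtr_gt0 invr_gt0.
have sV : s ^+ 2 * V = 1 by rewrite sqr_sqrtr ?invr_ge0 ?ltW// mulVf// gt_eqF.
have t0 : 0 < (Q + 1)^-1 by rewrite invr_gt0; lra.
rewrite mul1r (gtr0_norm t0) -[leLHS]/(`|s - (Q + 1)^-1|).
set t := (Q + 1)^-1 in t0 *; have tQ : t * (Q + 1) = 1 by rewrite mulVf//; lra.
have ts : t <= s.
  suff : t ^+ 2 <= s ^+ 2 by rewrite ler_pXn2r// nnegrE ltW.
  rewrite -(ler_pM2r V0) sV; rewrite /V.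
  apply: (@le_trans _ _ ((t * (Q + 1)) ^+ 2)); last by rewrite tQ expr1n.
  rewrite exprMn ler_wpM2l ?sqr_ge0// -subr_ge0.
  by rewrite (_ : _ - _ = Q) ?ltW//; ring.
rewrite ger0_norm ?subr_ge0//.
have eQ : 1 < e * Q by rewrite -ltr_pdivrMl// mulr1.
have st : s <= t * (1 + Q^-1).
  have ti0 : 0 < t * (1 + Q^-1) by rewrite mulr_gt0// addr_gt0// invr_gt0.
  suff : s ^+ 2 <= (t * (1 + Q^-1)) ^+ 2 by rewrite ler_pXn2r// nnegrE ltW.
  have -> : t * (1 + Q^-1) = Q^-1.
    by rewrite /t; field; rewrite gt_eqF//= gt_eqF//; lra.
  rewrite sqr_sqrtr ?invr_ge0 ?(ltW V0)// exprVn lef_pV2 ?posrE ?exprn_gt0//.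
  by rewrite /V; lra.
apply: (@le_trans _ _ (t * Q^-1)); first by lra.
rewrite mulrC; apply: ler_wpM2r; first exact: ltW.
by rewrite -[leLHS]mulr1 ler_pdivrMl// mulrC ltW.
Unshelve. all: by end_near. Qed.

End ProjGauge.

(** * The gauge and the digit blocks of hypercubes *)
Section CubeGauge.
Variable R : realType.
Implicit Types (x y a b u : R).

(** The ends 0, 2, 4, 8, ... of the digit blocks. *)
Definition lv_cube k : nat := if k is 0 then 0 else (2 ^ k)%N.

Let lvS k : (lv_cube k + 2 <= lv_cube k.+1)%N.
Proof.
rewrite /lv_cube; case: k => // k; rewrite [(2 ^ k.+2)%N]expnS mul2n -addnn leq_add2l.
by rewrite expnS -[X in (X <= _)%N]muln1 leq_mul2l expn_gt0.
Qed.

Lemma ln_inv_ge x : 0 < x -> 1 - x <= - ln x.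
Proof.
by move=> x0; rewrite lerNr opprB -[x in ln x](subrKC 1) le_ln1Dx//; lra.
Qed.

Let ln2_gt0 : 0 < ln (2 : R).
Proof. by rewrite ln_gt0// ltr1n. Qed.

Let h_cubeE x : 0 < x -> h_cube x = ln 2 / - ln x.
Proof. by move=> x0; rewrite /h_cube gt_eqF// lnV// invfM invrK mulrC. Qed.

Let lnN_gt0 x : 0 < x -> x < 1 -> 0 < - ln x.
Proof. by move=> x0 x1; apply: lt_le_trans (ln_inv_ge x0); rewrite subr_gt0. Qed.

Let h_cube0 : h_cube (0 : R) = 0.
Proof. by rewrite /h_cube eqxx. Qed.

Let h_cube_mono x y : 0 <= x -> x <= y -> y < 1 -> h_cube x <= h_cube y.
Proof.
rewrite le_eqVlt => /predU1P[<-|x0] xy y1.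
  rewrite h_cube0; move: xy; rewrite le_eqVlt => /predU1P[<-|y0]; first by rewrite h_cube0.
  by rewrite h_cubeE// divr_ge0 ?ltW// lnN_gt0.
have y0 := lt_le_trans x0 xy.
rewrite !h_cubeE//; apply: ler_wpM2l; first exact: ltW.
rewrite lef_pV2 ?posrE ?lnN_gt0//; last exact: le_lt_trans y1.
by rewrite lerN2 ler_ln ?posrE.
Qed.

Let h_cube_rc x : 0 <= x < 1 -> h_cube y @[y --> x^'+] --> h_cube x.
Proof.
move=> /andP[]; rewrite le_eqVlt => /predU1P[<- _|x0 x1].
  rewrite h_cube0; apply/cvgrPdist_le => e e0.
  have m0 : 0 < expR (- (ln 2 / e)) by exact: expR_gt0.
  near=> y; have y0 : 0 < y by near: y; exact: nbhs_right_gt.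
  have y1 : y < 1 by near: y; exact: nbhs_right_lt.
  have ym : y < expR (- (ln 2 / e)) by near: y; exact: nbhs_right_lt.
  have hy0 : 0 <= ln 2 / - ln y by rewrite divr_ge0 ?ltW ?lnN_gt0.
  rewrite sub0r normrN h_cubeE// ger0_norm//.
  rewrite ler_pdivrMr ?lnN_gt0// mulrC -ler_pdivrMr// lerNr.
  by rewrite -[leRHS]expRK ler_ln ?posrE// ltW.
have L0 := lnN_gt0 x0 x1.
have : (fun y => ln 2 / - ln y) y @[y --> x^'+] --> h_cube x.
  rewrite h_cubeE//; apply: cvg_at_right_filter; apply: cvgM; first exact: cvg_cst.
  apply: cvgV; first by rewrite gt_eqF.
  by apply: cvgN; exact: continuous_ln.
apply: cvg_trans; apply: near_eq_cvg; near=> y; rewrite h_cubeE//.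
by apply: (lt_trans x0); near: y; exact: nbhs_right_gt.
Unshelve. all: by end_near. Qed.

Let ln_half n : - ln ((2^-1 : R) ^+ n) = n%:R * ln 2.
Proof. by rewrite lnXn ?invr_gt0// lnV ?posrE// mulNrn opprK mulr_natl. Qed.

Lemma h_cube_half n : h_cube ((2^-1 : R) ^+ n) = n%:R^-1.
Proof. by rewrite h_cubeE ?exprn_gt0 ?invr_gt0// ln_half invfM mulrCA divff ?mulr1// gt_eqF. Qed.

(** There is equality at [a = b = u ^ 2]. Write [U = - ln u] and let [p] and [q]
be the relative defects of [a] and [b] from [u ^ 2]. As [- ln x >= 1 - x],
the logarithms satisfy [- ln a >= 2 U + p] and [- ln b >= 2 U + q], while
[- ln w] exceeds [U] by [2 u (p + q)] at most, which is much less when [u] is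
small. The remaining rational inequality has a positive first-order term. *)
Lemma h_cube_split u a b : 0 < u <= 16^-1 -> 0 <= a <= u ^+ 2 -> 0 <= b <= u ^+ 2 ->
  h_cube a + h_cube b <= h_cube (u - 2 * u ^+ 2 + a + b).
Proof.
move=> /andP[u0 u1] /andP[a0 a1] /andP[b0 b1].
have uu : u ^+ 2 <= u / 16 by rewrite expr2 ler_wpM2l ?(ltW u0).
have [a00|ane] := eqVneq a 0.
  by rewrite a00 h_cube0 add0r; apply: h_cube_mono; lra.
have [b00|bne] := eqVneq b 0.
  by rewrite b00 h_cube0 addr0; apply: h_cube_mono; lra.
have {ane}a0 : 0 < a by rewrite lt_def ane.
have {bne}b0 : 0 < b by rewrite lt_def bne.
set w := u - 2 * u ^+ 2 + a + b.
have w0 : 0 < w by rewrite /w; lra.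
have wu : w <= u by rewrite /w; lra.
rewrite !h_cubeE// -mulrDr; apply: ler_wpM2l; first exact: ltW.
have u20 : 0 < u ^+ 2 by rewrite exprn_gt0.
pose U := - ln u; pose p := 1 - a / u ^+ 2; pose q := 1 - b / u ^+ 2.
have U0 : 15 / 16 <= U by apply: le_trans (ln_inv_ge u0); lra.
have p0 : 0 <= p by rewrite subr_ge0 ler_pdivrMr// mul1r.
have q0 : 0 <= q by rewrite subr_ge0 ler_pdivrMr// mul1r.
have p1 : p <= 1 by rewrite gerBl divr_ge0// ltW.
have q1 : q <= 1 by rewrite gerBl divr_ge0// ltW.
have pq0 : 0 <= p + q by exact: addr_ge0.
have key c : 0 < c -> 2 * U + (1 - c / u ^+ 2) <= - ln c.
  move=> c0; have cu0 : 0 < c / u ^+ 2 by rewrite divr_gt0.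
  rewrite -[c in leRHS](divfK (x := u ^+ 2)) ?gt_eqF// lnM ?posrE// lnXn//.
  by have := ln_inv_ge cu0; rewrite /U; lra.
have Aa := key _ a0; have Bb := key _ b0; rewrite -/p in Aa; rewrite -/q in Bb.
have Lw : - ln w <= U + 2 * u * (p + q).
  have wu0 : 0 < u / w by rewrite divr_gt0.
  have -> : - ln w = U + ln (u / w) by rewrite lnM ?posrE ?invr_gt0// lnV ?posrE// /U; ring.
  rewrite lerD2l -[u / w](subrKC 1).
  apply: le_trans (le_ln1Dx _) _; first by lra.
  rewrite -[X in _ - X](divff (x := w)) ?gt_eqF// -mulrBl ler_pdivrMr//.
  have -> : u - w = u ^+ 2 * (p + q).
    by rewrite /w /p /q; field; rewrite gt_eqF.
  have -> : 2 * u * (p + q) * w = (2 * u * w) * (p + q) by ring.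
  rewrite ler_wpM2r// expr2.
  have : u / 2 <= w by rewrite /w; lra.
  by nra.
have L0 : 0 < - ln w by apply: lnN_gt0 => //; lra.
apply: (@le_trans _ _ ((2 * U + p)^-1 + (2 * U + q)^-1)).
  by apply: lerD; rewrite lef_pV2 ?posrE; lra.
apply: (@le_trans _ _ (U + 2 * u * (p + q))^-1); last first.
  by rewrite lef_pV2 ?posrE//; apply: lt_le_trans Lw.
have up : 0 <= u * (p + q) by apply: mulr_ge0 => //; exact: ltW.
have ul : u * (p + q) <= 8^-1.
  by apply: (@le_trans _ _ (16^-1 * 2)); [apply: ler_pM; lra|lra].
have -> : (2 * U + p)^-1 + (2 * U + q)^-1 = (4 * U + (p + q)) / ((2 * U + p) * (2 * U + q)).
  by field; rewrite !gt_eqF//; lra.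
rewrite ler_pdivrMr ?mulr_gt0//; [|lra|lra].
rewrite -ler_pdivrMl ?invr_gt0; last by lra.
rewrite invrK -subr_ge0.
have -> : (2 * U + p) * (2 * U + q) - (U + 2 * u * (p + q)) * (4 * U + (p + q)) =
  (p + q) * (U * (1 - 8 * u) - 2 * (u * (p + q))) + p * q by ring.
apply: addr_ge0; last exact: mulr_ge0.
apply: mulr_ge0 => //; rewrite subr_ge0.
apply: (@le_trans _ _ (15 / 16 * 2^-1)); first by lra.
by apply: ler_pM => //; lra.
Qed.

Lemma cube_cantor_gauge : cantor_gauge lv_cube (@h_cube R).
Proof.
split=> //.
- by move=> k; rewrite /mesh /= h_cube_half natrX exprVn.
(* This makes [mesh k] at most 1/16 in [h_cube_split], which excludes level 0,
   where the next mesh is not the square of this one. *)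
exists 32^-1; first by rewrite invr_gt0 ltr0n /= lef_pV2 ?posrE ?ler_nat.
move=> [|k] a b; first by rewrite /mesh expr0; lra.
have -> : mesh R lv_cube k.+2 = mesh R lv_cube k.+1 ^+ 2.
  by rewrite /mesh /= -exprM [(2 ^ k.+2)%N]expnSr.
move=> mk; apply: h_cube_split; rewrite mesh_gt0/=; lra.
Qed.

Lemma S_cubeE : @S_cube R = @cantor R lv_cube 0.
Proof.
rewrite -binary_cantor//.
congr (_ @` _); apply/seteqP; split=> a /=.
  move=> [a0 ai] [|k]; first by [].
  by have := ai k.+1 isT; rewrite addn1.
move=> H; split=> [|[|i] // _]; first exact: (H 0%N).
by have := H i.+1; rewrite addn1.
Qed.

End CubeGauge.

(** * The two limits *)
Theorem proposition4p38 (R : realType) :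
  euclidean_limit (fun n => hypercube n.+1) (fun n => n.+1)
    (hausdorff (@h_cube R)) (W_of (@S_cube R)) /\
  (forall (q : nat -> nat) (P L : nat -> finType)
          (inc : forall n, P n -> L n -> bool),
     (forall n, projective_plane (inc n) (q n)) ->
     q n @[n --> \oo] --> \oo ->
     euclidean_limit (fun n => incidence_graph (inc n)) (fun n => (q n).+1)
       (hausdorff (@h_proj R)) (W_of (@S_proj R))).
Proof.
split=> [|q P L inc pp qoo].
  rewrite S_cubeE; apply: (cantor_euclidean_limit (cube_cantor_gauge R)).
  - by move=> n; exact: hypercube_sparse_regular.
  - by move=> A [N _ NA]; exists N => // n /= Nn; apply: NA; exact: leqW.
  rewrite (_ : (fun n => h_cube _) = fun n => 1 / n.+1%:R); first exact: equiv_refl.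
  by apply/funext => n; rewrite nv_hypercube natrX !div1r -exprVn h_cube_half.
rewrite S_projE; apply: (cantor_euclidean_limit (proj_cantor_gauge R)).
- by move=> n; exact: incidence_sparse_regular (pp n).
- move=> A [N _ NA]; apply: (qoo [set k | A k.+1]).
  by exists N => // k /= Nk; apply: NA; exact: leqW.
rewrite (_ : (fun n => h_proj _) =
  fun n => @h_proj R (1 / (2 * (q n * q n + q n + 1))%:R)); first exact: h_proj_asym.
by apply/funext => n; rewrite (nv_incidence_graph (pp n)).
Qed.
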